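(* For $n\in\mathbb N=\{0,1,2,\dots\}$ let $P_n=(\cos(2^{-n}),\sin(2^{-n}))\in S^1$, and let $\mathcal C\subset\mathbb R^2$ be the open convex hull of $\{P_n,-P_n : n\in\mathbb N\}$. Then the limit $\lim_{R\to+\infty}\frac1R\ln[\mu_{\mathcal C}(\mathcal B_{\mathcal C}(0,R))]$ exists and equals $0$.
   Context: Let $\mathcal C\subset\mathbb R^m$ be a nonempty open bounded convex set. For distinct $p,q\in\mathcal C$, let $a,b$ be the intersection points of the straight line through $p,q$ with $\partial\mathcal C$, labelled so that $p=(1-s)a+sb$ and $q=(1-t)a+tb$ with $0<s<t<1$; the Hilbert metric is $d_{\mathcal C}(p,q)=\frac12\ln\!\big(\frac{1-s}{s}\cdot\frac{t}{1-t}\big)$, and $d_{\mathcal C}(p,p)=0$. The associated Finsler norm at $p\in\mathcal C$ is $F_{\mathcal C}(p,v)=\frac12\big(\frac1{t^-}+\frac1{t^+}\big)$ for $v\neq0$, where $t^\pm>0$ are the unique numbers with $p-t^-v\in\partial\mathcal C$ and $p+t^+v\in\partial\mathcal C$, and $F_{\mathcal C}(p,0)=0$. Let $B_{\mathcal C}(p)=\{v\in\mathbb R^m : F_{\mathcal C}(p,v)<1\}$, let $\mathrm{vol}$ be Lebesgue measure on $\mathbb R^m$ and $\omega_m$ the Lebesgue volume of the Euclidean unit ball (so $\omega_2=\pi$). The Hilbert measure is $\mu_{\mathcal C}(A)=\int_A\frac{\omega_m}{\mathrm{vol}(B_{\mathcal C}(p))}\,d\mathrm{vol}(p)$ for Borel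 $A\subset\mathcal C$. When $0\in\mathcal C$ and $R>0$, $\mathcal B_{\mathcal C}(0,R)=\{p\in\mathcal C : d_{\mathcal C}(0,p)<R\}$ denotes the open metric ball. *)

(* Defs.v *)
From Stdlib Require Import Reals Lra List.
Open Scope R_scope.

Definition pt : Type := (R * R)%type.
Definition pt3 : Type := (R * R * R)%type.
Definition padd (p q : pt) : pt := (fst p + fst q, snd p + snd q).
Definition pscal (a : R) (p : pt) : pt := (a * fst p, a * snd p).
Definition dist2 (p q : pt) : R :=
  sqrt ((fst p - fst q) ^ 2 + (snd p - snd q) ^ 2).

Definition conv_hull (S : pt -> Prop) (x : pt) : Prop :=
  exists l : list (R * pt),
    Forall (fun wp => 0 <= fst wp /\ S (snd wp)) l /\
    fold_right Rplus 0 (map fst l) = 1 /\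
    x = fold_right (fun wp acc => padd (pscal (fst wp) (snd wp)) acc) (0, 0) l.

Definition interior (A : pt -> Prop) (x : pt) : Prop :=
  exists eps, 0 < eps /\ forall y, dist2 x y < eps -> A y.
Definition closure (A : pt -> Prop) (x : pt) : Prop :=
  forall eps, 0 < eps -> exists y, A y /\ dist2 x y < eps.
Definition boundary (A : pt -> Prop) (x : pt) : Prop :=
  closure A x /\ ~ interior A x.

Definition hilbert_dist (C : pt -> Prop) (p q : pt) (r : R) : Prop :=
  (p = q /\ r = 0) \/
  (p <> q /\ exists (a b : pt) (s t : R),
      boundary C a /\ boundary C b /\ 0 < s /\ s < t /\ t < 1 /\
      p = padd (pscal (1 - s) a) (pscal s b) /\
      q = padd (pscal (1 - t) a) (pscal t b) /\
      r = / 2 * ln ((1 - s) / s * (t / (1 - t)))).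

Definition hilbert_ball (C : pt -> Prop) (R0 : R) (p : pt) : Prop :=
  C p /\ exists r, hilbert_dist C (0, 0) p r /\ r < R0.

Definition finsler_unit_ball (C : pt -> Prop) (p : pt) (v : pt) : Prop :=
  v = (0, 0) \/
  (v <> (0, 0) /\ exists tm tp, 0 < tm /\ 0 < tp /\
     boundary C (padd p (pscal (- tm) v)) /\ boundary C (padd p (pscal tp v)) /\
     / 2 * (/ tm + / tp) < 1).

(** Lebesgue (outer) measure on R^2 and R^3 via countable covers by closed boxes.
    lebesgueK E m  <->  the Lebesgue outer measure of E is the finite real m. *)
Definition cover_sum2 (E : pt -> Prop) (c : R) : Prop :=
  exists lo hi : nat -> pt,
    (forall n, fst (lo n) <= fst (hi n) /\ snd (lo n) <= snd (hi n)) /\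
    (forall x, E x -> exists n,
        fst (lo n) <= fst x <= fst (hi n) /\ snd (lo n) <= snd x <= snd (hi n)) /\
    infinite_sum (fun n => (fst (hi n) - fst (lo n)) * (snd (hi n) - snd (lo n))) c.

Definition lebesgue2 (E : pt -> Prop) (m : R) : Prop :=
  (forall c, cover_sum2 E c -> m <= c) /\
  (forall eps, 0 < eps -> exists c, cover_sum2 E c /\ c < m + eps).

Definition cover_sum3 (E : pt3 -> Prop) (c : R) : Prop :=
  exists lo hi : nat -> pt3,
    (forall n, fst (fst (lo n)) <= fst (fst (hi n)) /\
               snd (fst (lo n)) <= snd (fst (hi n)) /\
               snd (lo n) <= snd (hi n)) /\
    (forall x, E x -> exists n,
        fst (fst (lo n)) <= fst (fst x) <= fst (fst (hi n)) /\
        snd (fst (lo n)) <= snd (fst x) <= snd (fst (hi n)) /\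
        snd (lo n) <= snd x <= snd (hi n)) /\
    infinite_sum (fun n => (fst (fst (hi n)) - fst (fst (lo n))) *
                           (snd (fst (hi n)) - snd (fst (lo n))) *
                           (snd (hi n) - snd (lo n))) c.

Definition lebesgue3 (E : pt3 -> Prop) (m : R) : Prop :=
  (forall c, cover_sum3 E c -> m <= c) /\
  (forall eps, 0 < eps -> exists c, cover_sum3 E c /\ c < m + eps).

(** Hilbert measure mu_C(A) = int_A omega_2 / vol(B_C(p)) dvol(p), with omega_2 = PI,
    the integral of the nonnegative density being the 3-dimensional Lebesgue
    measure of its subgraph over A. hilbert_measure C A m <-> mu_C(A) = m. *)
Definition hilbert_measure (C : pt -> Prop) (A : pt -> Prop) (m : R) : Prop :=
  lebesgue3 (fun x : pt3 =>
     A (fst x) /\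
     exists w, lebesgue2 (finsler_unit_ball C (fst x)) w /\
               0 <= snd x < PI / w) m.

Definition Pn (n : nat) : pt := (cos (/ 2 ^ n), sin (/ 2 ^ n)).
Definition Sgen (x : pt) : Prop := exists n : nat, x = Pn n \/ x = pscal (-1) (Pn n).
Definition Cex : pt -> Prop := interior (conv_hull Sgen).

(* Main.v *)
(** For [R >= 0] the ball of radius [R] about [0] lies in [1 - e^(-2R)] times the
    closure of the convex set. Cut the set into cones over the edges of the polygon with
    vertices [P_0, ..., P_N, -P_0, ..., -P_N], where [N] is about [4R]; the part of the set
    outside this polygon has relative width [O(2^(-N))] and is absorbed by the scaling.
    By central symmetry the parallelogram [A, B, -A, -B] over an edge [AB] is
    contained in the set. In the affine chart that turns it into the square
    [(-1, 1)^2], comparison with the square bounds the Hilbert density by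
    [const / ((1 - |a|) (1 - |b|))], whose integral over the scaled cone is [O(N^2)],
    uniformly in the edge. Hence the ball has measure [O(R^3)]. As it contains a fixed
    neighbourhood of [0], its measure is also bounded below. *)

From Stdlib Require Import Reals ZArith Lra Lia List Classical ClassicalEpsilon.
From Coquelicot Require Compactness.
Require Import Defs.
Import ListNotations.
Open Scope R_scope.

(** * Finite box covers *)

(** The Hilbert measure is by definition the outer measure of a subgraph, so no integral is ever
    evaluated. An upper bound for it needs an upper bound for the density, hence a lower bound for
    the outer area of a Finsler ball. That direction speaks about every countable cover, and it is
    where compactness enters; for upper bounds it is enough to exhibit covers, and finite ones
    suffice. The charts of the edges are linear but do not preserve axis-parallel boxes, so the
    behaviour of finite box covers under linear maps takes the place of a change of variables.
    Uniformity in the edge is a cancellation: the lower bound for the area of the Finsler ball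
    carries the factor [|det A B| / 2], which is also the Jacobian of the chart, so that short edges
    cost as much as long ones. Growth is polynomial because the vertices converge geometrically: a
    resolution exponentially small in the radius takes only a linear number of edges. *)

Notation px x := (fst (fst x)).
Notation py x := (snd (fst x)).
Notation pz x := (snd x).

Lemma Rle_plus_eps x y : (forall eps : posreal, x <= y + eps) -> x <= y.
Proof.
  intros H. apply Rnot_lt_le. intros Hlt.
  assert (He : 0 < (x - y) / 2) by lra.
  specialize (H (mkposreal _ He)). simpl in H. lra.
Qed.

Lemma Rabs_le_inv a b : Rabs a <= b -> - b <= a <= b.
Proof.
  intros H. assert (H1 := Rle_abs a). assert (H2 := Rle_abs (- a)).
  rewrite Rabs_Ropp in H2. lra.
Qed.

Definition box : Type := (pt3 * pt3)%type.

Definition inb (b : box) (x : pt3) : Prop :=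
  px (fst b) <= px x <= px (snd b) /\
  py (fst b) <= py x <= py (snd b) /\
  pz (fst b) <= pz x <= pz (snd b).

Definition valid (b : box) : Prop :=
  px (fst b) <= px (snd b) /\ py (fst b) <= py (snd b) /\ pz (fst b) <= pz (snd b).

Definition vol (b : box) : R :=
  (px (snd b) - px (fst b)) * (py (snd b) - py (fst b)) * (pz (snd b) - pz (fst b)).

Definition Rsum {T : Type} (f : T -> R) (l : list T) : R :=
  fold_right (fun t s => f t + s) 0 l.

Lemma Rsum_app {T} (f : T -> R) l1 l2 : Rsum f (l1 ++ l2) = Rsum f l1 + Rsum f l2.
Proof. induction l1 as [|t l1 IH]; simpl; [|rewrite IH]; ring. Qed.

Lemma Rsum_plus {T} (f g : T -> R) l : Rsum (fun t => f t + g t) l = Rsum f l + Rsum g l.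
Proof. induction l as [|t l IH]; simpl; [|rewrite IH]; ring. Qed.

Lemma Rsum_le {T} (f g : T -> R) l :
  (forall t, In t l -> f t <= g t) -> Rsum f l <= Rsum g l.
Proof.
  induction l as [|t l IH]; intros H; simpl; [lra|].
  apply Rplus_le_compat; [apply H; now left|apply IH; intros; apply H; now right].
Qed.

Lemma Rsum_eq {T} (f g : T -> R) l :
  (forall t, In t l -> f t = g t) -> Rsum f l = Rsum g l.
Proof.
  intros H; apply Rle_antisym; apply Rsum_le; intros t Ht; rewrite (H t Ht); lra.
Qed.

Lemma Rsum_map {T U} (f : U -> R) (g : T -> U) l : Rsum f (map g l) = Rsum (fun t => f (g t)) l.
Proof. induction l as [|t l IH]; simpl; [|rewrite IH]; reflexivity. Qed.

Lemma Rsum_const {T} c (l : list T) : Rsum (fun _ => c) l = INR (length l) * c.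
Proof. induction l as [|t l IH]; [simpl; ring|]. cbn [length]; rewrite S_INR; simpl; rewrite IH; ring. Qed.

Lemma Rsum_nonneg {T} (f : T -> R) l : (forall t, In t l -> 0 <= f t) -> 0 <= Rsum f l.
Proof.
  intros H; replace 0 with (Rsum (fun _ : T => 0) l) by (rewrite Rsum_const; ring).
  now apply Rsum_le.
Qed.

Lemma Rsum_ge_term {T} (f : T -> R) l t :
  (forall t, In t l -> 0 <= f t) -> In t l -> f t <= Rsum f l.
Proof.
  induction l as [|u l IH]; intros H Ht; [destruct Ht|simpl].
  destruct Ht as [<-|Ht].
  - assert (0 <= Rsum f l) by (apply Rsum_nonneg; intros; apply H; now right). lra.
  - assert (f t <= Rsum f l) by (apply IH; [intros; apply H; now right|exact Ht]).
    assert (0 <= f u) by (apply H; now left). lra.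
Qed.

Definition tvol (l : list box) : R := Rsum vol l.

Definition ind (a b x : R) : R :=
  if Rle_dec a x then if Rle_dec x b then 1 else 0 else 0.

Definition overlap (a b c d : R) : R := Rmax 0 (Rmin b d - Rmax a c).

Lemma overlap_cut a b c d e :
  a <= b -> c <= e <= d -> overlap a b c d = overlap a b c e + overlap a b e d.
Proof.
  intros; unfold overlap, Rmax, Rmin.
  repeat destruct Rle_dec; lra.
Qed.

Lemma overlap_le a b c d : a <= b -> overlap a b c d <= b - a.
Proof.
  intros; unfold overlap, Rmax, Rmin; repeat destruct Rle_dec; lra.
Qed.

Lemma overlap_nonneg a b c d : 0 <= overlap a b c d.
Proof. apply Rmax_l. Qed.

Lemma ind_nonneg a b x : 0 <= ind a b x.
Proof. unfold ind; repeat destruct Rle_dec; lra. Qed.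

Lemma ind_in a b x : a <= x <= b -> ind a b x = 1.
Proof. intros H; unfold ind; repeat destruct Rle_dec; lra. Qed.

(* Induction on the list: the endpoints of the first interval cut [(a, b)] into
   three pieces, on each of which its indicator function is constant. *)
Lemma weighted_interval_cover {T} (lo hi w : T -> R) (l : list T) :
  (forall t, In t l -> lo t <= hi t) ->
  forall W a b, a <= b ->
  (forall x, a < x < b -> W <= Rsum (fun t => w t * ind (lo t) (hi t) x) l) ->
  W * (b - a) <= Rsum (fun t => w t * overlap (lo t) (hi t) a b) l.
Proof.
  induction l as [|t l IH]; intros Hl W a b Hab H.
  - simpl in *. destruct (Req_dec a b) as [->|Hne]; [lra|].
    specialize (H ((a + b) / 2) ltac:(lra)). nra.
  - assert (Ht : lo t <= hi t) by (apply Hl; now left).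
    assert (Hl' : forall t, In t l -> lo t <= hi t) by (intros; apply Hl; now right).
    specialize (IH Hl').
    set (c := Rmax a (Rmin b (lo t))); set (d := Rmax a (Rmin b (hi t))).
    assert (Hcd : a <= c <= d /\ d <= b /\ overlap (lo t) (hi t) a b = d - c).
    { unfold c, d, overlap, Rmax, Rmin; repeat destruct Rle_dec; lra. }
    destruct Hcd as [[Hac Hcd] [Hdb Hov]].
    assert (H1 : W * (c - a) <= Rsum (fun t => w t * overlap (lo t) (hi t) a c) l).
    { apply IH; [lra|]. intros x Hx. specialize (H x ltac:(lra)). simpl in H.
      assert (x < lo t).
      { destruct Hx as [Hx1 Hx2]; revert Hx2; unfold c, Rmax, Rmin;
        repeat destruct Rle_dec; lra. }
      unfold ind at 1 in H. destruct Rle_dec in H; lra. }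
    assert (H2 : (W - w t) * (d - c) <= Rsum (fun t => w t * overlap (lo t) (hi t) c d) l).
    { apply IH; [lra|]. intros x Hx. specialize (H x ltac:(lra)). simpl in H.
      assert (lo t <= x <= hi t).
      { destruct Hx as [Hx1 Hx2]; revert Hx1 Hx2; unfold c, d, Rmax, Rmin;
        repeat destruct Rle_dec; lra. }
      unfold ind at 1 in H. destruct Rle_dec in H; [|lra]. destruct Rle_dec in H; lra. }
    assert (H3 : W * (b - d) <= Rsum (fun t => w t * overlap (lo t) (hi t) d b) l).
    { apply IH; [lra|]. intros x Hx. specialize (H x ltac:(lra)). simpl in H.
      assert (hi t < x).
      { destruct Hx as [Hx1 Hx2]; revert Hx1; unfold d, Rmax, Rmin;
        repeat destruct Rle_dec; lra. }
      unfold ind at 1 in H. destruct Rle_dec in H; [destruct Rle_dec in H|]; lra. }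
    simpl. rewrite Hov.
    rewrite (Rsum_eq (fun t => w t * overlap (lo t) (hi t) a b)
      (fun t => w t * overlap (lo t) (hi t) a c +
        (w t * overlap (lo t) (hi t) c d + w t * overlap (lo t) (hi t) d b))).
    2:{ intros u Hu. rewrite (overlap_cut _ _ a b c), (overlap_cut _ _ c b d);
        auto; try lra; ring. }
    rewrite !Rsum_plus. nra.
Qed.

(** Fubini for indicator functions: their sum over the cover is at least 1 inside [Q], and each use
    of [weighted_interval_cover] integrates out one coordinate, in the order z, y, x, with the
    factors of the other two coordinates as weights. *)
Lemma finite_cover_vol (Q : box) (l : list box) :
  valid Q -> Forall valid l ->
  (forall x, inb Q x -> exists b, In b l /\ inb b x) -> vol Q <= tvol l.
Proof.
  intros (Qx & Qy & Qz) Hl Hc. rewrite Forall_forall in Hl.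
  assert (H0 : forall x y z, px (fst Q) < x < px (snd Q) -> py (fst Q) < y < py (snd Q) ->
    pz (fst Q) < z < pz (snd Q) ->
    1 <= Rsum (fun b : box => (ind (px (fst b)) (px (snd b)) x * ind (py (fst b)) (py (snd b)) y)
                        * ind (pz (fst b)) (pz (snd b)) z) l).
  { intros x y z Hx Hy Hz.
    destruct (Hc ((x, y), z)) as [b [Hb (B1 & B2 & B3)]]; [unfold inb; simpl; lra|].
    simpl in *.
    refine (Rle_trans _ _ _ _ (Rsum_ge_term _ l b _ Hb)).
    - cbv beta. rewrite (ind_in _ _ _ B1), (ind_in _ _ _ B2), (ind_in _ _ _ B3). lra.
    - intros; apply Rmult_le_pos; [apply Rmult_le_pos|]; apply ind_nonneg. }
  assert (H1 : forall x y, px (fst Q) < x < px (snd Q) -> py (fst Q) < y < py (snd Q) ->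
    1 * (pz (snd Q) - pz (fst Q)) <=
    Rsum (fun b : box => (ind (px (fst b)) (px (snd b)) x
       * overlap (pz (fst b)) (pz (snd b)) (pz (fst Q)) (pz (snd Q)))
       * ind (py (fst b)) (py (snd b)) y) l).
  { intros x y Hx Hy.
    eapply Rle_trans.
    - apply (weighted_interval_cover (fun b : box => pz (fst b)) (fun b : box => pz (snd b))
       (fun b : box => ind (px (fst b)) (px (snd b)) x * ind (py (fst b)) (py (snd b)) y) l); auto.
      intros t Ht; apply (Hl t Ht).
    - right; apply Rsum_eq; intros; ring. }
  assert (H2 : forall x, px (fst Q) < x < px (snd Q) ->
    1 * (pz (snd Q) - pz (fst Q)) * (py (snd Q) - py (fst Q)) <=
    Rsum (fun b : box => (overlap (py (fst b)) (py (snd b)) (py (fst Q)) (py (snd Q))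
       * overlap (pz (fst b)) (pz (snd b)) (pz (fst Q)) (pz (snd Q)))
       * ind (px (fst b)) (px (snd b)) x) l).
  { intros x Hx.
    eapply Rle_trans.
    - apply (weighted_interval_cover (fun b : box => py (fst b)) (fun b : box => py (snd b))
       (fun b : box => ind (px (fst b)) (px (snd b)) x
         * overlap (pz (fst b)) (pz (snd b)) (pz (fst Q)) (pz (snd Q))) l); auto.
      intros t Ht; apply (Hl t Ht).
    - right; apply Rsum_eq; intros; ring. }
  assert (H3 : 1 * (pz (snd Q) - pz (fst Q)) * (py (snd Q) - py (fst Q))
      * (px (snd Q) - px (fst Q)) <=
    Rsum (fun b : box => (overlap (py (fst b)) (py (snd b)) (py (fst Q)) (py (snd Q))
       * overlap (pz (fst b)) (pz (snd b)) (pz (fst Q)) (pz (snd Q)))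
       * overlap (px (fst b)) (px (snd b)) (px (fst Q)) (px (snd Q))) l).
  { apply (weighted_interval_cover (fun b : box => px (fst b)) (fun b : box => px (snd b))
       (fun b : box => overlap (py (fst b)) (py (snd b)) (py (fst Q)) (py (snd Q))
         * overlap (pz (fst b)) (pz (snd b)) (pz (fst Q)) (pz (snd Q))) l); auto.
    intros t Ht; apply (Hl t Ht). }
  unfold vol at 1. eapply Rle_trans; [|eapply Rle_trans; [exact H3|]]; [right; ring|].
  apply Rsum_le. intros b Hb. destruct (Hl b Hb) as (Bx & By & Bz). unfold vol.
  rewrite (Rmult_assoc (px (snd b) - px (fst b))), (Rmult_comm (px (snd b) - px (fst b))).
  repeat (apply Rmult_le_compat || apply Rmult_le_pos || apply overlap_nonneg
    || (apply overlap_le; assumption)).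
Qed.

(** * Finite content and its behaviour under linear maps *)

(** An upper bound for the outer Jordan content. The slack [eps] is what lets shears preserve the
    bound: a sheared box has in general no finite cover of exactly its own volume. *)
Definition content_le (E : pt3 -> Prop) (c : R) : Prop :=
  forall eps, 0 < eps -> exists l, Forall valid l /\
    (forall x, E x -> exists b, In b l /\ inb b x) /\ tvol l < c + eps.

Lemma content_le_mono (E F : pt3 -> Prop) c d :
  (forall x, F x -> E x) -> c <= d -> content_le E c -> content_le F d.
Proof.
  intros HEF Hcd H eps He. destruct (H eps He) as (l & Hv & Hc & Ht).
  exists l; repeat split; auto. lra.
Qed.

Lemma content_le_box b : valid b -> content_le (inb b) (vol b).
Proof.
  intros Hb eps He. exists [b]. repeat split.
  - now constructor.
  - intros x Hx; exists b; split; [now left|exact Hx].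
  - unfold tvol; simpl. lra.
Qed.

Lemma content_le_empty (E : pt3 -> Prop) : (forall x, ~ E x) -> content_le E 0.
Proof.
  intros H eps He. exists []. repeat split; [constructor| |unfold tvol; simpl; lra].
  intros x Hx; destruct (H x Hx).
Qed.

Lemma content_le_union (E F : pt3 -> Prop) c d :
  content_le E c -> content_le F d -> content_le (fun x => E x \/ F x) (c + d).
Proof.
  intros HE HF eps He.
  destruct (HE (eps / 2) ltac:(lra)) as (l & Hv & Hc & Ht).
  destruct (HF (eps / 2) ltac:(lra)) as (l' & Hv' & Hc' & Ht').
  exists (l ++ l'). repeat split.
  - now apply Forall_app.
  - intros x [Hx|Hx]; [destruct (Hc x Hx) as [b [Hb Hi]]|destruct (Hc' x Hx) as [b [Hb Hi]]];
      exists b; (split; [apply in_or_app; auto|exact Hi]).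
  - unfold tvol in *; rewrite Rsum_app; lra.
Qed.

Lemma content_le_bigunion (E : nat -> pt3 -> Prop) c n :
  (forall i, (i < n)%nat -> content_le (E i) c) ->
  content_le (fun x => exists i, (i < n)%nat /\ E i x) (INR n * c).
Proof.
  induction n as [|n IH]; intros H.
  - simpl. rewrite Rmult_0_l. apply content_le_empty. intros x [i [Hi _]]; lia.
  - rewrite S_INR.
    eapply content_le_mono; [|right|exact (content_le_union _ _ _ _
      (IH (fun i Hi => H i (Nat.lt_trans _ _ _ Hi (Nat.lt_succ_diag_r n))))
      (H n (Nat.lt_succ_diag_r n)))]; [|ring].
    intros x [i [Hi Hx]]. destruct (Nat.eq_dec i n) as [->|Hne]; [now right|].
    left; exists i; split; [lia|exact Hx].
Qed.

Definition image (g : pt3 -> pt3) (E : pt3 -> Prop) (y : pt3) : Prop :=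
  exists x, E x /\ y = g x.

(** A factor valid for single boxes passes to all sets: each box of a cover of [E] is replaced by a
    cover of its image. *)
Lemma content_le_image (g : pt3 -> pt3) k (E : pt3 -> Prop) c :
  0 <= k -> (forall b, valid b -> content_le (image g (inb b)) (k * vol b)) ->
  content_le E c -> content_le (image g E) (k * c).
Proof.
  intros Hk Hg HE eps He.
  (* With [k + 1] the tolerance also makes sense for [k = 0]; after scaling by [k] it is at most
     [eps / 2]. *)
  destruct (HE (eps / (2 * (k + 1)))) as (l & Hv & Hc & Ht).
  { apply Rdiv_lt_0_compat; lra. }
  assert (Hu : content_le (fun y => exists b, In b l /\ image g (inb b) y) (k * tvol l)).
  { clear Hc Ht. induction Hv as [|b l Hb Hv IH].
    - unfold tvol; simpl. rewrite Rmult_0_r. apply content_le_empty.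
      intros y [b [[] _]].
    - eapply content_le_mono; [|right|exact (content_le_union _ _ _ _ (Hg b Hb) IH)].
      + intros y [b' [[<-|Hb'] Hy]]; [now left|right; exists b'; auto].
      + unfold tvol; simpl; ring. }
  destruct (Hu (eps / 2) ltac:(lra)) as (l' & Hv' & Hc' & Ht').
  exists l'; repeat split; [exact Hv'| |].
  - intros y [x [Hx ->]]. apply Hc'. destruct (Hc x Hx) as [b [Hb Hi]].
    exists b; split; [exact Hb|exists x; auto].
  - assert (k * (eps / (2 * (k + 1))) <= eps / 2).
    { replace (k * (eps / (2 * (k + 1)))) with (k / (k + 1) * (eps / 2)) by (field; lra).
      assert (k / (k + 1) <= 1).
      { apply Rmult_le_reg_r with (k + 1); [lra|]. unfold Rdiv.
        rewrite Rmult_assoc, Rinv_l; lra. }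
      nra. }
    assert (k * tvol l <= k * (c + eps / (2 * (k + 1)))) by (apply Rmult_le_compat_l; lra).
    lra.
Qed.

Lemma subdivide a b y k :
  (0 < k)%nat -> a <= y <= b -> exists i, (i < k)%nat /\
    a + INR i * ((b - a) / INR k) <= y <= a + INR i * ((b - a) / INR k) + (b - a) / INR k.
Proof.
  intros Hk Hy.
  assert (HK : 0 < INR k) by (now apply lt_0_INR).
  assert (G : forall m, y <= a + INR m * ((b - a) / INR k) -> (0 < m)%nat ->
    exists i, (i < m)%nat /\
    a + INR i * ((b - a) / INR k) <= y <= a + INR i * ((b - a) / INR k) + (b - a) / INR k).
  { induction m as [|m IH]; intros H1 H2; [lia|].
    destruct (Rle_dec (a + INR m * ((b - a) / INR k)) y) as [H3|H3].
    - exists m; split; [lia|]. rewrite S_INR in H1. lra.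
    - destruct m as [|m]; [simpl in H3; lra|].
      destruct IH as [i [Hi Hi']]; [lra|lia|]. exists i; split; [lia|exact Hi']. }
  apply G; [|exact Hk]. replace (INR k * ((b - a) / INR k)) with (b - a) by (field; lra). lra.
Qed.

Definition shear (s : R) (x : pt3) : pt3 := (px x + s * py x, py x, pz x).
Definition swap (x : pt3) : pt3 := (py x, px x, pz x).
Definition diag (p q : R) (x : pt3) : pt3 := (p * px x, q * py x, pz x).
Definition lin (p q r s : R) (x : pt3) : pt3 :=
  (p * px x + q * py x, r * px x + s * py x, pz x).

(* Slice the box into [k] layers; the shear of a layer of height [h] fits into a
   box that is only [2 |s| h] wider. *)
Lemma content_le_shear s E c : content_le E c -> content_le (image (shear s) E) c.
Proof.
  intros H. rewrite <- (Rmult_1_l c). apply content_le_image; [lra| |exact H].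
  clear E c H. intros [[[x0 y0] z0] [[x1 y1] z1]] (Hx & Hy & Hz) eps He. simpl in *.
  unfold vol; simpl.
  (* [C / INR k] is the total volume added by widening the [k] layers. *)
  set (C := 2 * Rabs s * (y1 - y0) * (y1 - y0) * (z1 - z0)).
  assert (HS := Rabs_pos s).
  assert (HC : 0 <= C) by (unfold C; repeat apply Rmult_le_pos; lra).
  destruct (INR_archimed eps (C + 1) He) as [k Hk].
  assert (Hk0 : (0 < k)%nat).
  { destruct k; [|lia]. simpl in Hk; lra. }
  assert (HK : 0 < INR k) by (now apply lt_0_INR).
  set (h := (y1 - y0) / INR k).
  assert (Hh : 0 <= h) by (unfold h; apply Rle_mult_inv_pos; lra).
  set (f := fun i : nat => (((x0 + s * (y0 + INR i * h) - Rabs s * h, y0 + INR i * h), z0),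
     ((x1 + s * (y0 + INR i * h) + Rabs s * h, y0 + INR i * h + h), z1)) : box).
  exists (map f (seq 0 k)). repeat split.
  - rewrite Forall_forall. intros b Hb. apply in_map_iff in Hb. destruct Hb as [i [<- _]].
    unfold f, valid; simpl. assert (0 <= Rabs s * h) by (apply Rmult_le_pos; lra).
    repeat split; lra.
  - intros y [[[x' y'] z'] [(Ix & Iy & Iz) ->]]. simpl in *.
    destruct (subdivide y0 y1 y' k Hk0 Iy) as [i [Hi Hi']]. fold h in Hi'.
    exists (f i). split.
    + apply in_map, in_seq. lia.
    + unfold inb, f, shear; simpl.
      assert (Rabs (s * (y' - (y0 + INR i * h))) <= Rabs s * h).
      { rewrite Rabs_mult. apply Rmult_le_compat_l; [lra|]. rewrite Rabs_pos_eq; lra. }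
      apply Rabs_le_inv in H. repeat split; lra.
  - unfold tvol. rewrite Rsum_map.
    rewrite (Rsum_eq _ (fun _ => (x1 - x0 + 2 * (Rabs s * h)) * h * (z1 - z0))).
    2:{ intros i _. unfold vol, f; simpl. ring. }
    rewrite Rsum_const, length_seq.
    replace (INR k * ((x1 - x0 + 2 * (Rabs s * h)) * h * (z1 - z0))) with
      ((x1 - x0) * (y1 - y0) * (z1 - z0) + C / INR k).
    2:{ unfold C, h. field. lra. }
    assert (C / INR k < eps).
    { apply Rmult_lt_reg_r with (INR k); [lra|]. unfold Rdiv. rewrite Rmult_assoc, Rinv_l; lra. }
    lra.
Qed.

Lemma content_le_swap E c : content_le E c -> content_le (image swap E) c.
Proof.
  intros H. rewrite <- (Rmult_1_l c). apply content_le_image; [lra| |exact H].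
  intros b (Hx & Hy & Hz).
  eapply content_le_mono; [| |apply (content_le_box (swap (fst b), swap (snd b)))].
  - intros y [x [(Ix & Iy & Iz) ->]]. repeat split; simpl; lra.
  - unfold vol; simpl; lra.
  - repeat split; simpl; lra.
Qed.

Lemma content_le_scale p E c :
  content_le E c -> content_le (image (diag p 1) E) (Rabs p * c).
Proof.
  intros H. assert (HP := Rabs_pos p). apply content_le_image; [lra| |exact H].
  intros [[[x0 y0] z0] [[x1 y1] z1]] (Hx & Hy & Hz); simpl in *.
  destruct (Rle_dec 0 p) as [Hp|Hp].
  - rewrite Rabs_pos_eq by lra.
    eapply content_le_mono; [| |apply (content_le_box ((p * x0, y0, z0), (p * x1, y1, z1)))].
    + intros y [x [(Ix & Iy & Iz) ->]]. unfold inb, diag; simpl in *.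
      repeat split; try lra; apply Rmult_le_compat_l; lra.
    + unfold vol; simpl; lra.
    + unfold valid; simpl; repeat split; try lra; apply Rmult_le_compat_l; lra.
  - rewrite Rabs_left by lra.
    eapply content_le_mono; [| |apply (content_le_box ((p * x1, y0, z0), (p * x0, y1, z1)))].
    + intros y [x [(Ix & Iy & Iz) ->]]. unfold inb, diag; simpl in *.
      repeat split; try lra; apply Rmult_le_compat_neg_l; lra.
    + unfold vol; simpl; lra.
    + unfold valid; simpl; repeat split; try lra; apply Rmult_le_compat_neg_l; lra.
Qed.

Lemma content_le_image_comp (g h k : pt3 -> pt3) E c :
  (forall x, k x = g (h x)) -> content_le (image g (image h E)) c -> content_le (image k E) c.
Proof.
  intros Hk. apply content_le_mono; [|lra].
  intros y [x [Hx ->]]. rewrite Hk. exists (h x); split; [exists x; auto|reflexivity].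
Qed.

Lemma pt3_eq (x y : pt3) : px x = px y -> py x = py y -> pz x = pz y -> x = y.
Proof. destruct x as [[? ?] ?], y as [[? ?] ?]; simpl; intros -> -> ->; reflexivity. Qed.

Lemma content_le_diag p q E c :
  content_le E c -> content_le (image (diag p q) E) (Rabs (p * q) * c).
Proof.
  intros H. rewrite Rabs_mult, Rmult_assoc.
  apply (content_le_image_comp (diag p 1) (diag 1 q)).
  { intros; apply pt3_eq; simpl; ring. }
  apply content_le_scale.
  apply (content_le_image_comp swap (fun x => diag q 1 (swap x))).
  { intros; apply pt3_eq; simpl; ring. }
  apply content_le_swap.
  apply (content_le_image_comp (diag q 1) swap); [reflexivity|].
  now apply content_le_scale, content_le_swap.
Qed.

(* The LDU factorization, for a nonzero pivot. *)
Lemma content_le_lin_pivot p q r s E c :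
  p <> 0 -> content_le E c -> content_le (image (lin p q r s) E) (Rabs (p * s - q * r) * c).
Proof.
  intros Hp H.
  apply (content_le_image_comp swap
    (fun x => shear (r / p) (swap (diag p ((p * s - q * r) / p) (shear (q / p) x))))).
  { intros x; apply pt3_eq; simpl; field; exact Hp. }
  apply content_le_swap.
  apply (content_le_image_comp (shear (r / p))
    (fun x => swap (diag p ((p * s - q * r) / p) (shear (q / p) x)))); [reflexivity|].
  apply content_le_shear.
  apply (content_le_image_comp swap
    (fun x => diag p ((p * s - q * r) / p) (shear (q / p) x))); [reflexivity|].
  apply content_le_swap.
  apply (content_le_image_comp (diag p ((p * s - q * r) / p)) (shear (q / p))); [reflexivity|].
  replace (p * s - q * r) with (p * ((p * s - q * r) / p)) at 2 by (field; exact Hp).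
  now apply content_le_diag, content_le_shear.
Qed.

(** If [p = 0], precomposition with [swap] exchanges the columns and makes [q] the pivot, which is
    nonzero because the determinant is. *)
Lemma content_le_lin p q r s E c :
  p * s - q * r <> 0 -> content_le E c ->
  content_le (image (lin p q r s) E) (Rabs (p * s - q * r) * c).
Proof.
  intros Hd H. destruct (Req_dec p 0) as [Hp|Hp]; [|now apply content_le_lin_pivot].
  apply (content_le_image_comp (lin q p s r) swap).
  { intros; apply pt3_eq; simpl; ring. }
  replace (Rabs (p * s - q * r)) with (Rabs (q * r - p * s)) by apply Rabs_minus_sym.
  apply content_le_lin_pivot; [|now apply content_le_swap].
  intros ->; apply Hd; rewrite Hp; ring.
Qed.

(** * Lower bounds for outer measures *)

Definition fatten (d : R) (b : box) : box :=
  ((px (fst b) - d, py (fst b) - d, pz (fst b) - d),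
   (px (snd b) + d, py (snd b) + d, pz (snd b) + d)).

Lemma fatten_vol b eps :
  valid b -> 0 < eps -> exists d, 0 < d /\ vol (fatten d b) <= vol b + eps.
Proof.
  destruct b as [[[x0 y0] z0] [[x1 y1] z1]]. intros (Hx & Hy & Hz) He.
  unfold vol, fatten; simpl in *.
  set (u := x1 - x0); set (v := y1 - y0); set (w := z1 - z0).
  assert (0 <= u /\ 0 <= v /\ 0 <= w) by (unfold u, v, w; lra).
  set (K := 2 * (u * v + v * w + u * w) + 4 * (u + v + w) + 8).
  assert (HK : 0 < K).
  { unfold K. assert (0 <= u * v) by nra. assert (0 <= v * w) by nra.
    assert (0 <= u * w) by nra. lra. }
  (* This choice gives [d <= 1] and [d * K <= eps] at once, and for [d <= 1] the added volume is at
     most [d * K]. *)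
  set (d := eps / (K + eps)).
  assert (Hd : 0 < d) by (apply Rdiv_lt_0_compat; lra).
  assert (HdE : d * (K + eps) = eps) by (unfold d; field; lra).
  assert (Hd1 : d <= 1) by nra.
  exists d. split; [exact Hd|].
  replace (x1 + d - (x0 - d)) with (u + 2 * d) by (unfold u; ring).
  replace (y1 + d - (y0 - d)) with (v + 2 * d) by (unfold v; ring).
  replace (z1 + d - (z0 - d)) with (w + 2 * d) by (unfold w; ring).
  assert (HdK : d * K <= eps) by nra.
  assert (d * d <= d) by nra. assert (d * d * d <= d) by nra.
  unfold K in HdK.
  replace ((u + 2 * d) * (v + 2 * d) * (w + 2 * d)) with
    (u * v * w + 2 * d * (u * v + v * w + u * w) + 4 * (d * d) * (u + v + w) + 8 * (d * d * d))
    by ring.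
  assert (4 * (d * d) * (u + v + w) <= 4 * d * (u + v + w)) by
    (apply Rmult_le_compat_r; lra).
  nra.
Qed.

Lemma sum_geom_half n : sum_f_R0 (fun k => / 2 ^ (S k)) n < 1.
Proof.
  assert (H : sum_f_R0 (fun k => / 2 ^ (S k)) n = 1 - / 2 ^ (S n)).
  { induction n as [|n IH]; [simpl; field|].
    rewrite tech5, IH. assert (2 ^ n <> 0) by (apply pow_nonzero; lra).
    simpl; field; auto. }
  rewrite H. assert (0 < / 2 ^ S n) by (apply Rinv_0_lt_compat, pow_lt; lra). lra.
Qed.

Lemma Rsum_seq_sum f n : Rsum f (seq 0 (S n)) = sum_f_R0 f n.
Proof.
  induction n as [|n IH]; [simpl; ring|].
  rewrite seq_S, Rsum_app, IH. simpl. ring.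
Qed.

Lemma lin_continuity p q r s x y d :
  0 < d -> Rabs (px y - px x) < d -> Rabs (py y - py x) < d -> Rabs (pz y - pz x) < d ->
  let K := Rabs p + Rabs q + Rabs r + Rabs s + 1 in
  Rabs (px (lin p q r s y) - px (lin p q r s x)) <= K * d /\
  Rabs (py (lin p q r s y) - py (lin p q r s x)) <= K * d /\
  Rabs (pz (lin p q r s y) - pz (lin p q r s x)) <= K * d.
Proof.
  intros Hd Hx Hy Hz K. simpl.
  assert (Hp := Rabs_pos p); assert (Hq := Rabs_pos q);
  assert (Hr := Rabs_pos r); assert (Hs := Rabs_pos s).
  replace (p * px y + q * py y - (p * px x + q * py x)) with
    (p * (px y - px x) + q * (py y - py x)) by ring.
  replace (r * px y + s * py y - (r * px x + s * py x)) with
    (r * (px y - px x) + s * (py y - py x)) by ring.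
  assert (A : forall a t, Rabs t < d -> Rabs (a * t) <= Rabs a * d).
  { intros a t Ht. rewrite Rabs_mult. apply Rmult_le_compat_l; [apply Rabs_pos|lra]. }
  assert (H1 := Rabs_triang (p * (px y - px x)) (q * (py y - py x))).
  assert (H2 := Rabs_triang (r * (px y - px x)) (s * (py y - py x))).
  assert (H3 := A p _ Hx). assert (H4 := A q _ Hy).
  assert (H5 := A r _ Hx). assert (H6 := A s _ Hy).
  unfold K; repeat split; nra.
Qed.

(* Heine-Borel on the parameter box reduces a countable cover, slightly fattened,
   to a finite one. *)
Lemma cover_sum3_content E c p q r s (Q : box) :
  cover_sum3 E c -> (forall x, inb Q x -> E (lin p q r s x)) ->
  content_le (image (lin p q r s) (inb Q)) c.
Proof.
  intros (lo & hi & Hv & Hc & Hs) HE eps He.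
  assert (Hv' : forall n, valid (lo n, hi n)) by exact Hv.
  assert (Hfat : forall n, exists d, 0 < d /\
    vol (fatten d (lo n, hi n)) <= vol (lo n, hi n) + eps * / 2 ^ (S n)).
  { intros n; apply fatten_vol; [apply Hv'|].
    apply Rmult_lt_0_compat; [lra|apply Rinv_0_lt_compat, pow_lt; lra]. }
  apply choice in Hfat. destruct Hfat as [d Hd].
  set (g := lin p q r s). set (F := fun n => fatten (d n) (lo n, hi n)).
  set (K := Rabs p + Rabs q + Rabs r + Rabs s + 1).
  assert (HK : 0 < K).
  { unfold K; assert (Hp := Rabs_pos p); assert (Hq := Rabs_pos q);
    assert (Hr := Rabs_pos r); assert (Hs' := Rabs_pos s); lra. }
  assert (Hloc : forall t : pt3, exists nd : nat * posreal, inb Q t ->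
     forall x, Rabs (px x - px t) < snd nd -> Rabs (py x - py t) < snd nd ->
       Rabs (pz x - pz t) < snd nd -> inb (F (fst nd)) (g x)).
  { intros t. destruct (classic (inb Q t)) as [Ht|Ht].
    (* The gauge for compactness must be defined at every parameter; outside [Q] its value is
       arbitrary. *)
    2:{ exists (0%nat, mkposreal 1 Rlt_0_1). intros; contradiction. }
    destruct (Hc (g t) (HE t Ht)) as [n Hn].
    assert (Hdn : 0 < d n / K) by (apply Rdiv_lt_0_compat; [apply Hd|exact HK]).
    exists (n, mkposreal _ Hdn). intros _ x Hx Hy Hz. simpl in Hx, Hy, Hz.
    destruct (lin_continuity p q r s t x (d n / K) Hdn Hx Hy Hz) as (A & B & C).
    fold K g in A, B, C.
    replace (K * (d n / K)) with (d n) in A, B, C by (field; lra).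
    apply Rabs_le_inv in A, B, C.
    unfold inb, F, fatten; cbn [fst snd]. lra. }
  apply choice in Hloc. destruct Hloc as [nd Hnd].
  set (ofT := fun t : Compactness.Tn 3 R =>
     match t with (a, (b, (e, _))) => ((a, b, e) : pt3) end).
  set (toT := fun x : pt3 => (px x, (py x, (pz x, tt))) : Compactness.Tn 3 R).
  assert (Hcomp := Compactness.compactness_list 3 (toT (fst Q)) (toT (snd Q))
     (fun t => snd (nd (ofT t)))).
  apply NNPP in Hcomp. destruct Hcomp as [L HL].
  (* All boxes up to the largest index of the finite subcover are kept, so that their volumes form a
     partial sum of the given series. *)
  set (M := list_max (map (fun t => fst (nd (ofT t))) L)).
  exists (map F (seq 0 (S M))). repeat split.
  - rewrite Forall_forall. intros b Hb. apply in_map_iff in Hb. destruct Hb as [i [<- _]].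
    destruct (Hv' i) as (A & B & C). assert (HdP := proj1 (Hd i)).
    unfold valid, F, fatten; cbn [fst snd] in *. lra.
  - intros y [x [Hx ->]].
    destruct (HL (toT x)) as [t (Ht & Hbt & Hcl)].
    { destruct Hx as (A & B & C). repeat split; apply A || apply B || apply C. }
    exists (F (fst (nd (ofT t)))). split.
    + apply in_map, in_seq. split; [lia|].
      assert (Hmax := proj1 (list_max_le (map (fun t => fst (nd (ofT t))) L) M) (Nat.le_refl _)).
      rewrite Forall_forall in Hmax.
      assert (fst (nd (ofT t)) <= M)%nat by (apply Hmax; exact (in_map _ _ _ Ht)).
      lia.
    + destruct t as [t1 [t2 [t3 []]]]. simpl in Hbt, Hcl.
      apply Hnd; simpl; try tauto.
      unfold inb; simpl; tauto.
  - unfold tvol. rewrite Rsum_map, Rsum_seq_sum.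
    assert (H1 : sum_f_R0 (fun n => vol (F n)) M <=
      sum_f_R0 (fun n => vol (lo n, hi n) + eps * / 2 ^ (S n)) M).
    { apply sum_Rle. intros n _. apply Hd. }
    assert (H2 : sum_f_R0 (fun n => eps * / 2 ^ (S n)) M < eps).
    { replace (sum_f_R0 (fun n => eps * / 2 ^ (S n)) M) with
        (eps * sum_f_R0 (fun n => / 2 ^ (S n)) M).
      - assert (HG := sum_geom_half M). nra.
      - rewrite scal_sum. apply sum_eq. intros; ring. }
    assert (H3 : sum_f_R0 (fun n => vol (lo n, hi n)) M <= c).
    { apply sum_incr; [exact Hs|]. intros n. destruct (Hv' n) as (A & B & C).
      unfold vol; cbn [fst snd] in *. repeat apply Rmult_le_pos; lra. }
    rewrite sum_plus in H1. lra.
Qed.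

(** By compactness the image of [Q] has content at most [c]. Carried back by the inverse matrix, [Q]
    has content at most [c] divided by [|p s - q r|], and [finite_cover_vol] compares this with its
    volume. *)
Lemma cover_sum3_ge E c p q r s (Q : box) :
  p * s - q * r <> 0 -> valid Q -> cover_sum3 E c ->
  (forall x, inb Q x -> E (lin p q r s x)) -> Rabs (p * s - q * r) * vol Q <= c.
Proof.
  intros Hd HQ HE Hin.
  assert (H := cover_sum3_content E c p q r s Q HE Hin).
  set (D := p * s - q * r) in *.
  assert (HD : 0 < Rabs D) by (now apply Rabs_pos_lt).
  assert (HdI : (s / D) * (p / D) - (- q / D) * (- r / D) = / D).
  { replace ((s / D) * (p / D) - (- q / D) * (- r / D)) with (D / (D * D))
      by (unfold D; field; exact Hd). field; exact Hd. }
  apply (content_le_lin (s / D) (- q / D) (- r / D) (p / D)) in H.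
  2:{ rewrite HdI. now apply Rinv_neq_0_compat. }
  rewrite HdI, Rabs_inv in H.
  assert (H' : content_le (inb Q) (/ Rabs D * c)).
  { revert H. apply content_le_mono; [|lra].
    intros x Hx. exists (lin p q r s x). split; [exists x; auto|].
    apply pt3_eq; simpl; unfold D; field; exact Hd. }
  assert (HV : vol Q <= / Rabs D * c).
  { apply Rle_plus_eps. intros e. destruct (H' e (cond_pos e)) as (l & Hl & Hcov & Ht).
    assert (HF := finite_cover_vol Q l HQ Hl Hcov). lra. }
  apply Rmult_le_compat_l with (r := Rabs D) in HV; [|lra].
  rewrite <- Rmult_assoc, Rinv_r, Rmult_1_l in HV by lra. exact HV.
Qed.

(** A factor [[0, 1]] turns areas into equal volumes, so that the bounds in space serve in the
    plane. *)
Lemma cover_sum2_prod (E : pt -> Prop) c :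
  cover_sum2 E c -> cover_sum3 (fun x => E (fst x) /\ 0 <= snd x <= 1) c.
Proof.
  intros (lo & hi & Hv & Hc & Hs).
  exists (fun n => (lo n, 0)), (fun n => (hi n, 1)). repeat split; simpl.
  - apply Hv.
  - apply Hv.
  - lra.
  - intros x [Hx Hz]. destruct (Hc _ Hx) as [n Hn]. exists n. tauto.
  - intros e He. destruct (Hs e He) as [N HN]. exists N. intros n Hn.
    rewrite (sum_eq _ (fun n => (fst (hi n) - fst (lo n)) * (snd (hi n) - snd (lo n))));
      [now apply HN|]. intros; ring.
Qed.

Lemma lebesgue2_ge E w p q r s x0 x1 y0 y1 :
  p * s - q * r <> 0 -> x0 <= x1 -> y0 <= y1 -> lebesgue2 E w ->
  (forall x y, x0 <= x <= x1 -> y0 <= y <= y1 -> E (p * x + q * y, r * x + s * y)) ->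
  Rabs (p * s - q * r) * ((x1 - x0) * (y1 - y0)) <= w.
Proof.
  intros Hd Hx Hy [_ Hw] HE. apply Rle_plus_eps. intros e.
  destruct (Hw e (cond_pos e)) as [c [Hc Hlt]].
  apply cover_sum2_prod in Hc.
  assert (H := cover_sum3_ge (fun x => E (fst x) /\ 0 <= snd x <= 1) c p q r s
    ((x0, y0, 0), (x1, y1, 1)) Hd).
  unfold vol, valid, inb in H; simpl in H.
  assert (Rabs (p * s - q * r) * ((x1 - x0) * (y1 - y0) * (1 - 0)) <= c).
  { apply H; [repeat split; lra|exact Hc|]. intros x Hx'. split; [apply HE; tauto|tauto]. }
  lra.
Qed.

(** * Existence of outer measures and upper bounds from finite covers *)

Lemma infinite_sum_nonneg f c : (forall n, 0 <= f n) -> infinite_sum f c -> 0 <= c.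
Proof.
  intros Hf Hs. apply Rle_trans with (sum_f_R0 f 0); [simpl; apply Hf|].
  now apply sum_incr.
Qed.

Lemma infimum_exists (A : R -> Prop) :
  (exists c, A c) -> (forall c, A c -> 0 <= c) ->
  exists m, (forall c, A c -> m <= c) /\ (forall eps, 0 < eps -> exists c, A c /\ c < m + eps).
Proof.
  intros [c0 Hc0] Hpos.
  destruct (completeness (fun x => A (- x))) as [m [Hub Hlub]].
  - exists 0. intros x Hx. apply Hpos in Hx. lra.
  - exists (- c0). now rewrite Ropp_involutive.
  - exists (- m). split.
    + intros c Hc. assert (- c <= m) by (apply Hub; now rewrite Ropp_involutive). lra.
    + intros eps He. apply NNPP. intros Hn.
      assert (m <= m - eps); [|lra]. apply Hlub. intros x Hx.
      apply Rnot_lt_le. intros Hlt. apply Hn. exists (- x). split; [exact Hx|lra].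
Qed.

Lemma lebesgue2_exists E : (exists c, cover_sum2 E c) -> exists m, lebesgue2 E m.
Proof.
  intros H. apply infimum_exists; [exact H|].
  intros c (lo & hi & Hv & _ & Hs). apply infinite_sum_nonneg in Hs; [exact Hs|].
  intros n. destruct (Hv n). apply Rmult_le_pos; lra.
Qed.

Lemma lebesgue3_exists E : (exists c, cover_sum3 E c) -> exists m, lebesgue3 E m.
Proof.
  intros H. apply infimum_exists; [exact H|].
  intros c (lo & hi & Hv & _ & Hs). apply infinite_sum_nonneg in Hs; [exact Hs|].
  intros n. destruct (Hv n) as (? & ? & ?). repeat apply Rmult_le_pos; lra.
Qed.

Lemma cover_sum3_mono (E F : pt3 -> Prop) c :
  (forall x, F x -> E x) -> cover_sum3 E c -> cover_sum3 F c.
Proof.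
  intros H (lo & hi & Hv & Hc & Hs). exists lo, hi. repeat split; auto; apply Hv.
Qed.

Lemma infinite_sum_finite f (n : nat) :
  (forall k, (n <= k)%nat -> f k = 0) -> infinite_sum f (Rsum f (seq 0 n)).
Proof.
  intros Hf e He. exists n. intros k Hk.
  replace (sum_f_R0 f k) with (Rsum f (seq 0 n)).
  { unfold R_dist; rewrite Rminus_diag, Rabs_R0; exact He. }
  rewrite <- Rsum_seq_sum. replace (S k) with (n + (S k - n))%nat by lia.
  rewrite seq_app, Rsum_app. rewrite (Rsum_eq f (fun _ => 0) (seq (0 + n) _)).
  - rewrite Rsum_const; ring.
  - intros i Hi. apply in_seq in Hi. apply Hf. lia.
Qed.

Lemma Rsum_nth {T} (f : T -> R) d l :
  Rsum (fun n => f (nth n l d)) (seq 0 (length l)) = Rsum f l.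
Proof.
  induction l as [|t l IH]; [reflexivity|].
  cbn [length seq]. rewrite <- seq_shift. simpl. rewrite Rsum_map. simpl.
  now rewrite IH.
Qed.

Lemma content_le_cover E c eps :
  content_le E c -> 0 < eps -> exists c', cover_sum3 E c' /\ c' < c + eps.
Proof.
  intros H He. destruct (H eps He) as (l & Hv & Hc & Ht).
  exists (tvol l). split; [|exact Ht].
  (* A degenerate box of volume 0 pads the finite list to a sequence. *)
  set (b0 := ((0, 0, 0), (0, 0, 0)) : box).
  assert (Hv0 : forall n, valid (nth n l b0)).
  { intros n. destruct (Nat.lt_ge_cases n (length l)) as [Hn|Hn].
    - rewrite Forall_forall in Hv. now apply Hv, nth_In.
    - rewrite nth_overflow by exact Hn. unfold valid; simpl; lra. }
  exists (fun n => fst (nth n l b0)), (fun n => snd (nth n l b0)). repeat split; try apply Hv0.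
  - intros x Hx. destruct (Hc x Hx) as [b [Hb Hi]].
    destruct (In_nth l b b0 Hb) as [n [_ Hn]]. exists n. rewrite Hn. exact Hi.
  - unfold tvol. rewrite <- (Rsum_nth vol b0).
    apply (infinite_sum_finite (fun n => vol (nth n l b0))).
    intros k Hk. rewrite nth_overflow by exact Hk. unfold vol, b0; simpl; ring.
Qed.

Lemma content_le_lebesgue3 E c m : content_le E c -> lebesgue3 E m -> m <= c.
Proof.
  intros H [Hm _]. apply Rle_plus_eps. intros e.
  destruct (content_le_cover E c e H (cond_pos e)) as [c' [Hc' Hlt]].
  specialize (Hm _ Hc'). lra.
Qed.

(** * The Hilbert geometry in the chart of an edge *)

Lemma Rabs_lt_1 a : Rabs a < 1 -> -1 < a < 1.
Proof. intros H; apply Rabs_def2 in H; lra. Qed.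

Lemma dist2_ge_fst x y : Rabs (fst y - fst x) <= dist2 x y.
Proof.
  unfold dist2. rewrite <- (sqrt_Rsqr_abs (fst y - fst x)). apply sqrt_le_1_alt.
  unfold Rsqr. assert (0 <= (snd x - snd y) ^ 2) by (apply pow2_ge_0). nra.
Qed.

Lemma dist2_ge_snd x y : Rabs (snd y - snd x) <= dist2 x y.
Proof.
  unfold dist2. rewrite <- (sqrt_Rsqr_abs (snd y - snd x)). apply sqrt_le_1_alt.
  unfold Rsqr. assert (0 <= (fst x - fst y) ^ 2) by (apply pow2_ge_0). nra.
Qed.

Lemma dist2_le x y : dist2 x y <= Rabs (fst y - fst x) + Rabs (snd y - snd x).
Proof.
  assert (H1 := Rabs_pos (fst y - fst x)). assert (H2 := Rabs_pos (snd y - snd x)).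
  unfold dist2. rewrite <- (sqrt_Rsqr (Rabs (fst y - fst x) + Rabs (snd y - snd x))) by lra.
  apply sqrt_le_1_alt. unfold Rsqr.
  assert (E1 : (fst x - fst y) ^ 2 = Rabs (fst y - fst x) * Rabs (fst y - fst x)).
  { rewrite <- Rabs_mult, Rabs_pos_eq; [ring|apply Rle_0_sqr]. }
  assert (E2 : (snd x - snd y) ^ 2 = Rabs (snd y - snd x) * Rabs (snd y - snd x)).
  { rewrite <- Rabs_mult, Rabs_pos_eq; [ring|apply Rle_0_sqr]. }
  rewrite E1, E2. nra.
Qed.

Lemma interior_box (A : pt -> Prop) x :
  interior A x <-> exists e, 0 < e /\ forall y, Rabs (fst y - fst x) < e ->
    Rabs (snd y - snd x) < e -> A y.
Proof.
  split; intros [e [He H]].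
  - exists (e / 2). split; [lra|]. intros y H1 H2. apply H.
    assert (H3 := dist2_le x y). lra.
  - exists e. split; [exact He|]. intros y Hy.
    assert (H1 := dist2_ge_fst x y). assert (H2 := dist2_ge_snd x y). apply H; lra.
Qed.

Lemma interior_subset (A : pt -> Prop) x : interior A x -> A x.
Proof.
  rewrite interior_box. intros [e [He H]].
  apply H; rewrite Rminus_diag, Rabs_R0; exact He.
Qed.

Lemma conv_hull_halfplane (S : pt -> Prop) u v c x :
  (forall y, S y -> u * fst y + v * snd y <= c) -> conv_hull S x ->
  u * fst x + v * snd x <= c.
Proof.
  intros H [l [Hl [Hs ->]]].
  apply Rle_trans with (c * fold_right Rplus 0 (map fst l)); [|rewrite Hs; lra].
  clear Hs. induction Hl as [|[t y] l [Ht Hy] _ IH]; simpl in *; [lra|].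
  specialize (H y Hy). nra.
Qed.

Lemma closure_halfplane (A : pt -> Prop) u v c x :
  (forall y, A y -> u * fst y + v * snd y <= c) -> closure A x ->
  u * fst x + v * snd x <= c.
Proof.
  intros H Hx. apply Rnot_lt_le. intros Hlt.
  set (K := Rabs u + Rabs v + 1).
  assert (Hu := Rabs_pos u). assert (Hv := Rabs_pos v).
  assert (HK : 0 < K) by (unfold K; lra).
  set (e := (u * fst x + v * snd x - c) / K).
  assert (HeK : e * K = u * fst x + v * snd x - c) by (unfold e; field; lra).
  assert (He : 0 < e) by (apply Rdiv_lt_0_compat; lra).
  destruct (Hx e He) as [y [Hy Hd]].
  assert (H1 := dist2_ge_fst x y). assert (H2 := dist2_ge_snd x y).
  specialize (H y Hy).
  assert (G1 : Rabs (u * (fst y - fst x)) <= Rabs u * e).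
  { rewrite Rabs_mult. apply Rmult_le_compat_l; lra. }
  assert (G2 : Rabs (v * (snd y - snd x)) <= Rabs v * e).
  { rewrite Rabs_mult. apply Rmult_le_compat_l; lra. }
  apply Rabs_le_inv in G1, G2.
  assert (HeK' : e * K = Rabs u * e + Rabs v * e + e) by (unfold K; ring). lra.
Qed.

(** The outer estimates of the set rest on this lemma: a half-plane is tested on the generators
    only. The inner estimates rest on [conv_hull_chart]. *)
Lemma closure_Cex_halfplane u v c x :
  (forall y, Sgen y -> u * fst y + v * snd y <= c) -> closure Cex x ->
  u * fst x + v * snd x <= c.
Proof.
  intros H. apply closure_halfplane. intros y Hy.
  apply (conv_hull_halfplane Sgen); [exact H|]. now apply interior_subset.
Qed.

Lemma subset_closure (A : pt -> Prop) x : A x -> closure A x.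
Proof.
  intros H e He. exists x. split; [exact H|].
  assert (G := dist2_le x x). rewrite !Rminus_diag, !Rabs_R0 in G. lra.
Qed.

Lemma Sgen_Pn n : Sgen (Pn n).
Proof. exists n; now left. Qed.

Lemma Sgen_opp x : Sgen x -> Sgen (pscal (-1) x).
Proof.
  intros [n [->| ->]]; exists n; [now right|left].
  unfold pscal; simpl. unfold Pn. f_equal; simpl; ring.
Qed.

Lemma Sgen_bound x : Sgen x -> -1 <= fst x <= 1 /\ -1 <= snd x <= 1.
Proof.
  intros [n H].
  assert (H1 := COS_bound (/ 2 ^ n)). assert (H2 := SIN_bound (/ 2 ^ n)).
  destruct H as [->| ->]; unfold pscal, Pn; cbn [fst snd]; lra.
Qed.

Lemma closure_Cex_bound x : closure Cex x -> -1 <= fst x <= 1 /\ -1 <= snd x <= 1.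
Proof.
  intros H.
  assert (H1 := closure_Cex_halfplane 1 0 1 x).
  assert (H2 := closure_Cex_halfplane (-1) 0 1 x).
  assert (H3 := closure_Cex_halfplane 0 1 1 x).
  assert (H4 := closure_Cex_halfplane 0 (-1) 1 x).
  assert (HB := Sgen_bound).
  assert (E1 : 1 * fst x + 0 * snd x <= 1) by (apply H1; [intros y Hy; specialize (HB y Hy); lra|exact H]).
  assert (E2 : -1 * fst x + 0 * snd x <= 1) by (apply H2; [intros y Hy; specialize (HB y Hy); lra|exact H]).
  assert (E3 : 0 * fst x + 1 * snd x <= 1) by (apply H3; [intros y Hy; specialize (HB y Hy); lra|exact H]).
  assert (E4 : 0 * fst x + -1 * snd x <= 1) by (apply H4; [intros y Hy; specialize (HB y Hy); lra|exact H]).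
  lra.
Qed.

Definition det (p q : pt) : R := fst p * snd q - snd p * fst q.

(* [u A + v B] in the coordinates [a = u + v], [b = u - v], in which the
   parallelogram with vertices [A, B, -A, -B] is the square [(-1, 1)^2]. *)
Definition chart (A B : pt) (a b : R) : pt :=
  ((fst A + fst B) / 2 * a + (fst A - fst B) / 2 * b,
   (snd A + snd B) / 2 * a + (snd A - snd B) / 2 * b).

Lemma chart_jacobian A B :
  (fst A + fst B) / 2 * ((snd A - snd B) / 2) - (fst A - fst B) / 2 * ((snd A + snd B) / 2)
  = - (det A B / 2).
Proof. unfold det; field. Qed.

(** Cramer's rule for [x = u A + v B], rewritten in the coordinates [u + v] and [u - v]. *)
Lemma chart_surj A B x :
  det A B <> 0 ->
  x = chart A B ((det x B + det A x) / det A B) ((det x B - det A x) / det A B).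
Proof.
  intros HD. destruct x as [x1 x2]. unfold chart, det in *; simpl in *.
  f_equal; field; exact HD.
Qed.

(** The point is [u A + v B], where [|u| + |v|] is the maximum of [|a|] and [|b|]. The weights of
    [A] and [-A] differ by [u], those of [B] and [-B] by [v]; the slack [1 - |u| - |v|] is shared
    equally by [A] and [-A]. *)
Lemma conv_hull_chart A B a b :
  Sgen A -> Sgen B -> -1 <= a <= 1 -> -1 <= b <= 1 -> conv_hull Sgen (chart A B a b).
Proof.
  intros HA HB Ha Hb.
  set (u := (a + b) / 2). set (v := (a - b) / 2).
  assert (Huv : Rabs u + Rabs v <= 1).
  { unfold u, v, Rabs; repeat destruct Rcase_abs; lra. }
  assert (Hu : - Rabs u <= u <= Rabs u) by (apply Rabs_le_inv; lra).
  assert (Hv : - Rabs v <= v <= Rabs v) by (apply Rabs_le_inv; lra).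
  exists [((1 - Rabs v + u) / 2, A); ((1 - Rabs v - u) / 2, pscal (-1) A);
          ((Rabs v + v) / 2, B); ((Rabs v - v) / 2, pscal (-1) B)].
  repeat split.
  - repeat (apply Forall_cons; [split; simpl; [lra|auto using Sgen_opp]|]). apply Forall_nil.
  - simpl; lra.
  - unfold chart, padd, pscal; simpl. f_equal; unfold u, v; field.
Qed.

(** Each numerator is a linear form in [x] whose two coefficients are at most 2 in absolute value,
    since generators lie in [[-1, 1]^2]; hence the factor 4. *)
Lemma chart_coord_bound A B x d :
  Sgen A -> Sgen B -> det A B <> 0 -> Rabs (fst x) <= d -> Rabs (snd x) <= d ->
  Rabs ((det x B + det A x) / det A B) <= 4 * d / Rabs (det A B) /\
  Rabs ((det x B - det A x) / det A B) <= 4 * d / Rabs (det A B).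
Proof.
  intros HA HB HD H1 H2.
  assert (HD' : 0 < / Rabs (det A B)) by (now apply Rinv_0_lt_compat, Rabs_pos_lt).
  assert (HA' := Sgen_bound A HA). assert (HB' := Sgen_bound B HB).
  assert (G : forall c t, -2 <= c <= 2 -> Rabs t <= d -> Rabs (c * t) <= 2 * d).
  { intros c t Hc Ht. rewrite Rabs_mult. apply Rmult_le_compat; try apply Rabs_pos; auto.
    now apply Rabs_le. }
  unfold Rdiv. rewrite !Rabs_mult, Rabs_inv.
  split; apply Rmult_le_compat_r; try lra.
  - replace (det x B + det A x) with ((snd B - snd A) * fst x + (fst A - fst B) * snd x)
      by (unfold det; ring).
    assert (G1 := G (snd B - snd A) (fst x) ltac:(lra) H1).
    assert (G2 := G (fst A - fst B) (snd x) ltac:(lra) H2).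
    assert (G3 := Rabs_triang ((snd B - snd A) * fst x) ((fst A - fst B) * snd x)). lra.
  - replace (det x B - det A x) with ((snd B + snd A) * fst x + (- fst A - fst B) * snd x)
      by (unfold det; ring).
    assert (G1 := G (snd B + snd A) (fst x) ltac:(lra) H1).
    assert (G2 := G (- fst A - fst B) (snd x) ltac:(lra) H2).
    assert (G3 := Rabs_triang ((snd B + snd A) * fst x) ((- fst A - fst B) * snd x)). lra.
Qed.

Lemma chart_plus A B a b x y t :
  padd (chart A B a b) (pscal t (chart A B x y)) = chart A B (a + t * x) (b + t * y).
Proof. unfold padd, pscal, chart; simpl; f_equal; ring. Qed.

Lemma Cex_chart A B a b :
  Sgen A -> Sgen B -> det A B <> 0 -> -1 < a < 1 -> -1 < b < 1 -> Cex (chart A B a b).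
Proof.
  intros HA HB HD Ha Hb. apply interior_box.
  assert (HD' : 0 < Rabs (det A B)) by (now apply Rabs_pos_lt).
  set (m := Rmin (1 - Rabs a) (1 - Rabs b)).
  assert (Hm : 0 < m).
  { unfold m; apply Rmin_glb_lt; unfold Rabs; destruct Rcase_abs; lra. }
  assert (Hma : m <= 1 - Rabs a) by apply Rmin_l.
  assert (Hmb : m <= 1 - Rabs b) by apply Rmin_r.
  assert (Ha' : - Rabs a <= a <= Rabs a) by (apply Rabs_le_inv; lra).
  assert (Hb' : - Rabs b <= b <= Rabs b) by (apply Rabs_le_inv; lra).
  (* By [chart_coord_bound] a displacement of this size changes either chart coordinate by at most
     [m], the distance to the nearest side of the square. *)
  exists (m * Rabs (det A B) / 4). split; [apply Rdiv_lt_0_compat; [nra|lra]|].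
  intros y H1 H2.
  set (h := (fst y - fst (chart A B a b), snd y - snd (chart A B a b))).
  assert (Ey : y = padd (chart A B a b) (pscal 1 h)).
  { destruct y; unfold padd, pscal, h; simpl; f_equal; ring. }
  destruct (chart_coord_bound A B h (m * Rabs (det A B) / 4)) as [G1 G2]; auto;
    try (unfold h; cbn [fst snd]; lra).
  replace (4 * (m * Rabs (det A B) / 4) / Rabs (det A B)) with m in G1, G2 by (field; lra).
  apply Rabs_le_inv in G1, G2.
  rewrite Ey, (chart_surj A B h HD), chart_plus, !Rmult_1_l.
  apply conv_hull_chart; auto; lra.
Qed.

(** [tau] is the supremum of the times at which the ray is in the set, finite because the set is
    bounded. Being a supremum it gives a point of the closure, and an interior point would allow a
    later time. *)
Lemma exit_point p v T :
  v <> (0, 0) -> 0 < T -> (forall t, 0 <= t < T -> Cex (padd p (pscal t v))) ->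
  exists tau, T <= tau /\ boundary Cex (padd p (pscal tau v)).
Proof.
  intros Hv HT H.
  set (K := Rabs (fst v) + Rabs (snd v)).
  assert (H1 := Rabs_pos (fst v)). assert (H2 := Rabs_pos (snd v)).
  assert (HK : 0 < K).
  { unfold K. destruct (Req_dec (fst v) 0) as [E1|E1].
    - destruct (Req_dec (snd v) 0) as [E2|E2].
      + destruct v; simpl in *; subst; now destruct Hv.
      + apply Rabs_pos_lt in E2; lra.
    - apply Rabs_pos_lt in E1; lra. }
  set (U := fun t => 0 <= t /\ Cex (padd p (pscal t v))).
  destruct (completeness U) as [tau [Hub Hlub]].
  - exists ((2 + Rabs (fst p) + Rabs (snd p)) / K). intros t [Ht Hc].
    apply subset_closure, closure_Cex_bound in Hc. simpl in Hc.
    apply Rmult_le_reg_r with K; [exact HK|].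
    replace ((2 + Rabs (fst p) + Rabs (snd p)) / K * K) with (2 + Rabs (fst p) + Rabs (snd p))
      by (field; lra).
    assert (G : forall a b, -1 <= a + t * b <= 1 -> t * Rabs b <= 1 + Rabs a).
    { intros a b Hab. rewrite <- (Rabs_pos_eq t) at 1 by exact Ht. rewrite <- Rabs_mult.
      unfold Rabs; repeat destruct Rcase_abs; lra. }
    assert (G1 := G _ _ (proj1 Hc)). assert (G2 := G _ _ (proj2 Hc)).
    unfold K. lra.
  - exists 0. split; [lra|]. apply H; lra.
  - assert (HTt : T <= tau).
    { apply Rnot_lt_le. intros Hlt.
      assert (H0 : 0 <= tau) by (apply Hub; split; [lra|apply H; lra]).
      assert ((tau + T) / 2 <= tau); [|lra].
      apply Hub. split; [lra|apply H; lra]. }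
    exists tau. split; [exact HTt|]. split.
    + intros e He. assert (HeK : 0 < e / (K + 1)) by (apply Rdiv_lt_0_compat; lra).
      assert (Hex : exists t, U t /\ tau - e / (K + 1) < t).
      { apply NNPP. intros Hn. assert (tau <= tau - e / (K + 1)); [|lra].
        apply Hlub. intros t Ht. apply Rnot_lt_le. intros Hlt. apply Hn. now exists t. }
      destruct Hex as [t [Ht Hlt]]. exists (padd p (pscal t v)). split; [apply Ht|].
      apply Hub in Ht.
      eapply Rle_lt_trans; [apply dist2_le|]. simpl.
      replace (fst p + t * fst v - (fst p + tau * fst v)) with ((t - tau) * fst v) by ring.
      replace (snd p + t * snd v - (snd p + tau * snd v)) with ((t - tau) * snd v) by ring.
      rewrite !Rabs_mult, <- Rmult_plus_distr_l. fold K.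
      assert (Rabs (t - tau) <= e / (K + 1)) by (apply Rabs_le; lra).
      apply Rle_lt_trans with (e / (K + 1) * K).
      * apply Rmult_le_compat_r; lra.
      * replace e with (e / (K + 1) * K + e / (K + 1)) at 2 by (field; lra). lra.
    + rewrite interior_box. intros [e [He Hi]].
      assert (HeK : 0 < e / (K + 1)) by (apply Rdiv_lt_0_compat; lra).
      assert (HeK' : e / (K + 1) * K + e / (K + 1) = e) by (field; lra).
      assert (tau + e / (K + 1) <= tau); [|lra].
      apply Hub. split; [lra|].
      apply Hi; simpl.
      * replace (fst p + (tau + e / (K + 1)) * fst v - (fst p + tau * fst v)) with
          (e / (K + 1) * fst v) by ring.
        rewrite Rabs_mult, (Rabs_pos_eq (e / (K + 1))) by lra. unfold K in *. nra.
      * replace (snd p + (tau + e / (K + 1)) * snd v - (snd p + tau * snd v)) with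
          (e / (K + 1) * snd v) by ring.
        rewrite Rabs_mult, (Rabs_pos_eq (e / (K + 1))) by lra. unfold K in *. nra.
Qed.

(** * The area of the Finsler unit balls *)

(** For [-2 < t < 2] the point with coordinates [a + t x] and [b + t y] stays in the open square, so
    both exit times are at least 2 and the norm is at most 1/2. *)
Lemma finsler_ball_chart A B a b x y :
  Sgen A -> Sgen B -> det A B <> 0 -> -1 < a < 1 -> -1 < b < 1 ->
  Rabs x <= (1 - Rabs a) / 2 -> Rabs y <= (1 - Rabs b) / 2 ->
  finsler_unit_ball Cex (chart A B a b) (chart A B x y).
Proof.
  intros HA HB HD Ha Hb Hx Hy.
  destruct (classic (chart A B x y = (0, 0))) as [E|E]; [now left|right].
  split; [exact E|].
  assert (G : forall c z t, -1 < c < 1 -> Rabs z <= (1 - Rabs c) / 2 -> -2 < t < 2 ->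
    -1 < c + t * z < 1).
  { intros c z t Hc Hz Ht. apply Rabs_lt_1. eapply Rle_lt_trans; [apply Rabs_triang|].
    rewrite Rabs_mult. assert (Rabs t < 2) by (apply Rabs_def1; lra).
    assert (Rabs c < 1) by (apply Rabs_def1; lra).
    assert (Rabs t * Rabs z <= Rabs t * ((1 - Rabs c) / 2)).
    { apply Rmult_le_compat_l; [apply Rabs_pos|exact Hz]. }
    assert (Rabs t * (1 - Rabs c) < 2 * (1 - Rabs c)) by (apply Rmult_lt_compat_r; lra).
    lra. }
  destruct (exit_point (chart A B a b) (chart A B x y) 2) as [tp [Hp Bp]];
    [exact E|lra| |].
  { intros t Ht. rewrite chart_plus. apply Cex_chart; auto; apply G; auto; lra. }
  assert (En : pscal (-1) (chart A B x y) <> (0, 0)).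
  { intros En. apply E. injection En. intros E2 E1.
    unfold chart in *; simpl in *; f_equal; lra. }
  assert (Es : forall t, pscal t (pscal (-1) (chart A B x y)) = pscal (- t) (chart A B x y)).
  { intros t; unfold pscal; simpl; f_equal; ring. }
  destruct (exit_point (chart A B a b) (pscal (-1) (chart A B x y)) 2) as [tm [Hm Bm]];
    [exact En|lra| |].
  { intros t Ht. rewrite Es, chart_plus. apply Cex_chart; auto; apply G; auto; lra. }
  rewrite Es in Bm. exists tm, tp. repeat split; try lra; auto.
  1-4: apply Bm || apply Bp.
  assert (/ tm <= / 2) by (apply Rinv_le_contravar; lra).
  assert (/ tp <= / 2) by (apply Rinv_le_contravar; lra).
  lra.
Qed.

(** The vectors of [finsler_ball_chart] fill a parameter rectangle of area [(1 - |a|) (1 - |b|)];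
    the remaining factor is the Jacobian of the chart. *)
Lemma finsler_ball_area_ge A B a b w :
  Sgen A -> Sgen B -> det A B <> 0 -> -1 < a < 1 -> -1 < b < 1 ->
  lebesgue2 (finsler_unit_ball Cex (chart A B a b)) w ->
  Rabs (det A B) / 2 * ((1 - Rabs a) * (1 - Rabs b)) <= w.
Proof.
  intros HA HB HD Ha Hb Hw.
  assert (Ha' : Rabs a < 1) by (apply Rabs_def1; lra).
  assert (Hb' : Rabs b < 1) by (apply Rabs_def1; lra).
  assert (H := lebesgue2_ge (finsler_unit_ball Cex (chart A B a b)) w ((fst A + fst B) / 2) ((fst A - fst B) / 2)
    ((snd A + snd B) / 2) ((snd A - snd B) / 2)
    (- ((1 - Rabs a) / 2)) ((1 - Rabs a) / 2) (- ((1 - Rabs b) / 2)) ((1 - Rabs b) / 2)).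
  rewrite chart_jacobian, Rabs_Ropp in H.
  replace (Rabs (det A B / 2)) with (Rabs (det A B) / 2) in H
    by (unfold Rdiv; rewrite Rabs_mult, (Rabs_pos_eq (/ 2)); lra).
  eapply Rle_trans; [|apply H]; try lra; [exact Hw|].
  intros x y Hx Hy. apply (finsler_ball_chart A B a b x y); auto; now apply Rabs_le.
Qed.

(** Norm below 1 forces [tm + tp > 2], by comparison of the harmonic and arithmetic means. Both ends
    of the chord lie in [[-1, 1]^2] and differ by [(tm + tp) v]. *)
Lemma finsler_ball_bound p v :
  finsler_unit_ball Cex p v -> -1 <= fst v <= 1 /\ -1 <= snd v <= 1.
Proof.
  intros [->|[_ (tm & tp & Hm & Hp & [Bm _] & [Bp _] & HF)]]; [simpl; lra|].
  apply closure_Cex_bound in Bm, Bp. simpl in Bm, Bp.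
  assert (Hs : 2 < tm + tp).
  { assert (E : / tm + / tp = (tm + tp) / (tm * tp)) by (field; lra).
    rewrite E in HF.
    assert (0 < tm * tp) by nra.
    assert (tm + tp < 2 * (tm * tp)).
    { apply Rmult_lt_reg_r with (/ (tm * tp)); [now apply Rinv_0_lt_compat|].
      rewrite (Rmult_assoc 2), Rinv_r by lra. unfold Rdiv in HF. lra. }
    assert (Hsq := Rle_0_sqr (tm - tp)). unfold Rsqr in Hsq.
    apply Rnot_le_lt. intros Hle.
    assert ((tm + tp) * (tm + tp) <= 2 * (tm + tp)) by (apply Rmult_le_compat_r; lra).
    lra. }
  split; split; nra.
Qed.

Lemma finsler_ball_area_exists p :
  exists w, lebesgue2 (finsler_unit_ball Cex p) w /\ w <= 4.
Proof.
  assert (Hc : cover_sum2 (finsler_unit_ball Cex p) 4).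
  { exists (fun n => match n with O => (-1, -1) | _ => (0, 0) end),
      (fun n => match n with O => (1, 1) | _ => (0, 0) end). repeat split.
    - destruct n; simpl; lra.
    - destruct n; simpl; lra.
    - intros v Hv. exists 0%nat. simpl. now apply finsler_ball_bound in Hv.
    - set (f := fun n : nat => _).
      replace 4 with (Rsum f (seq 0 1)) by (unfold f; simpl; ring).
      apply infinite_sum_finite. intros [|k] Hk; [lia|]. unfold f; simpl; ring. }
  destruct (lebesgue2_exists _ (ex_intro _ 4 Hc)) as [w Hw].
  exists w. split; [exact Hw|]. now apply Hw.
Qed.

(** * The measure over one edge *)

Lemma dyadic_interval M a :
  (1 <= M)%nat -> 0 <= a <= 1 - / 2 ^ M ->
  exists i, (i < M)%nat /\ 1 - / 2 ^ i <= a <= 1 - / 2 ^ (S i).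
Proof.
  induction M as [|M IH]; intros HM Ha; [lia|].
  destruct (Rle_dec (1 - / 2 ^ M) a) as [H|H]; [exists M; split; [lia|lra]|].
  destruct M as [|M]; [simpl in H; lra|].
  destruct IH as [i [Hi Hi']]; [lia|lra|]. exists i; split; [lia|exact Hi'].
Qed.

(** Dyadic subdivision towards the sides of the square: [M * M] cells for each sign of the second
    coordinate. Over a cell with base of area [h i * h j] the height is at most [K / (h i * h j)],
    so every box has volume [K]. *)
Lemma content_le_hyperbolic K M :
  0 <= K -> (1 <= M)%nat ->
  content_le (fun x => 0 <= px x <= 1 - / 2 ^ M /\ Rabs (py x) <= 1 - / 2 ^ M /\
     0 <= pz x <= K / ((1 - px x) * (1 - Rabs (py x)))) (INR M * (INR M * (K + K))).
Proof.
  intros HK HM.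
  set (h := fun i => / 2 ^ (S i)).
  assert (Hh : forall i, 0 < h i) by (intros; apply Rinv_0_lt_compat, pow_lt; lra).
  assert (Hi2 : forall i, / 2 ^ i = 2 * h i).
  { intros i; unfold h; simpl. assert (2 ^ i <> 0) by (apply pow_nonzero; lra). field; auto. }
  set (bp := fun i j => ((1 - 2 * h i, 1 - 2 * h j, 0), (1 - h i, 1 - h j, K * / (h i * h j))) : box).
  set (bm := fun i j => ((1 - 2 * h i, - (1 - h j), 0), (1 - h i, - (1 - 2 * h j), K * / (h i * h j))) : box).
  assert (HKh : forall i j, 0 <= K * / (h i * h j)).
  { intros i j. apply Rmult_le_pos; [exact HK|].
    left. apply Rinv_0_lt_compat, Rmult_lt_0_compat; apply Hh. }
  apply (content_le_mono (fun x => exists i, (i < M)%nat /\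
     exists j, (j < M)%nat /\ (inb (bp i j) x \/ inb (bm i j) x)) _
     (INR M * (INR M * (K + K))) _); [|lra|].
  - intros [[a b] z] (Ha & Hb & Hz). cbn [fst snd] in *.
    destruct (dyadic_interval M a HM Ha) as [i [Hi Hai]].
    destruct (dyadic_interval M (Rabs b) HM) as [j [Hj Hbj]]; [split; [apply Rabs_pos|lra]|].
    exists i; split; [exact Hi|]; exists j; split; [exact Hj|].
    fold (h i) in Hai. fold (h j) in Hbj. rewrite Hi2 in Hai, Hbj.
    assert (Hz' : z <= K * / (h i * h j)).
    { apply Rle_trans with (1 := proj2 Hz). apply Rmult_le_compat_l; [exact HK|].
      assert (Hhi := Hh i). assert (Hhj := Hh j).
      apply Rinv_le_contravar; [nra|]. apply Rmult_le_compat; lra. }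
    destruct (Rle_dec 0 b) as [Hb0|Hb0].
    + left. rewrite Rabs_pos_eq in Hbj by lra. unfold inb, bp; cbn [fst snd]. lra.
    + right. rewrite Rabs_left in Hbj by lra. unfold inb, bm; cbn [fst snd]. lra.
  - apply content_le_bigunion. intros i _. apply content_le_bigunion. intros j _.
    assert (Hhi := Hh i). assert (Hhj := Hh j).
    apply content_le_union.
    + replace K with (vol (bp i j)) by (unfold vol, bp; cbn [fst snd]; field; lra).
      apply content_le_box. specialize (HKh i j). unfold valid, bp; cbn [fst snd]. lra.
    + replace K with (vol (bm i j)) by (unfold vol, bm; cbn [fst snd]; field; lra).
      apply content_le_box. specialize (HKh i j). unfold valid, bm; cbn [fst snd]. lra.
Qed.

Definition subgraph (x : pt3) : Prop :=
  exists w, lebesgue2 (finsler_unit_ball Cex (fst x)) w /\ 0 <= snd x < PI / w.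

(** The half-square [a >= 0] replaces the cone [|b| <= a], since the product structure makes it
    easier to cut into boxes. The density constant [PI / (|det A B| / 2)] cancels against the
    Jacobian, and the bound is free of the edge. *)
Lemma content_le_cone A B M :
  Sgen A -> Sgen B -> det A B <> 0 -> (1 <= M)%nat ->
  content_le (fun x => (exists a b, 0 <= a <= 1 - / 2 ^ M /\ Rabs b <= 1 - / 2 ^ M /\
     fst x = chart A B a b) /\ subgraph x) (2 * PI * INR M ^ 2).
Proof.
  intros HA HB HD HM.
  assert (HD' : 0 < Rabs (det A B)) by (now apply Rabs_pos_lt).
  assert (HPI := PI_RGT_0).
  set (K := PI / (Rabs (det A B) / 2)).
  assert (HK : 0 <= K) by (unfold K; apply Rle_mult_inv_pos; lra).
  assert (H := content_le_hyperbolic K M HK HM).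
  apply (content_le_lin ((fst A + fst B) / 2) ((fst A - fst B) / 2)
    ((snd A + snd B) / 2) ((snd A - snd B) / 2)) in H.
  2:{ rewrite chart_jacobian. lra. }
  rewrite chart_jacobian, Rabs_Ropp in H.
  replace (Rabs (det A B / 2)) with (Rabs (det A B) / 2) in H
    by (unfold Rdiv; rewrite Rabs_mult, (Rabs_pos_eq (/ 2)); lra).
  revert H. apply content_le_mono.
  2:{ unfold K. right. field. lra. }
  intros [p z] [(a & b & Ha & Hb & Hp) (w & Hw & Hz)]. cbn [fst snd] in *. subst p.
  assert (H2M : 0 < / 2 ^ M) by (apply Rinv_0_lt_compat, pow_lt; lra).
  assert (Hb' : -1 < b < 1) by (apply Rabs_lt_1; lra).
  assert (Hw' := finsler_ball_area_ge A B a b w HA HB HD ltac:(lra) Hb' Hw).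
  rewrite (Rabs_pos_eq a) in Hw' by lra.
  exists (a, b, z). split; [|reflexivity]. cbn [fst snd].
  repeat split; try lra.
  apply Rle_trans with (PI / w); [lra|].
  assert (0 < (1 - a) * (1 - Rabs b)) by (apply Rmult_lt_0_compat; lra).
  replace (K / ((1 - a) * (1 - Rabs b))) with
    (PI * / (Rabs (det A B) / 2 * ((1 - a) * (1 - Rabs b)))).
  2:{ unfold K. field. repeat split; lra. }
  apply Rmult_le_compat_l; [lra|]. apply Rinv_le_contravar; [|exact Hw'].
  apply Rmult_lt_0_compat; lra.
Qed.

(** * Covering the balls *)

Lemma inv_pow2_pos n : 0 < / 2 ^ n.
Proof. apply Rinv_0_lt_compat, pow_lt; lra. Qed.

Lemma inv_pow2_S n : / 2 ^ S n = / 2 ^ n / 2.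
Proof. assert (2 ^ n <> 0) by (apply pow_nonzero; lra). simpl; field; auto. Qed.

Lemma inv_pow2_le m n : (m <= n)%nat -> / 2 ^ n <= / 2 ^ m.
Proof. intros H. apply Rinv_le_contravar; [apply pow_lt; lra|apply Rle_pow; [lra|exact H]]. Qed.

Lemma inv_pow2_le_1 n : / 2 ^ n <= 1.
Proof. replace 1 with (/ 2 ^ 0) by (simpl; field). apply inv_pow2_le; lia. Qed.

Lemma PI_gt_3 : 3 < PI.
Proof. assert (H := PI2_3_2). lra. Qed.

Lemma det_Pn k n : det (Pn k) (Pn n) = sin (/ 2 ^ n - / 2 ^ k).
Proof. unfold det, Pn; cbn [fst snd]. rewrite sin_minus. ring. Qed.

Lemma det_opp_l p q : det (pscal (-1) p) q = - det p q.
Proof. unfold det, pscal; simpl; ring. Qed.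

Lemma det_opp_r p q : det p (pscal (-1) q) = - det p q.
Proof. unfold det, pscal; simpl; ring. Qed.

(** Here [a], [b], [k] are angles, and the upper bound says that the point at angle [k] is on the
    inner side of the chord from [a] to [b]. The sum is [2 sin((b - a) / 2)] times the cosine of the
    distance from [k] to the midpoint angle, which is at least [(b - a) / 2] outside the arc. *)
Lemma chord_support a b k :
  0 <= a -> a < b -> b <= 1 -> 0 <= k <= 1 -> k <= a \/ b <= k ->
  0 <= sin (b - k) + sin (k - a) <= sin (b - a).
Proof.
  intros Ha Hab Hb Hk Hc. assert (HPI := PI_gt_3).
  rewrite form3. replace ((b - k + (k - a)) / 2) with ((b - a) / 2) by field.
  assert (Hs : 0 <= sin ((b - a) / 2)) by (apply sin_ge_0; lra).
  replace (sin (b - a)) with (2 * sin ((b - a) / 2) * cos ((b - a) / 2)).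
  2:{ rewrite <- sin_2a. f_equal; field. }
  assert (Hcos : 0 <= cos ((b - k - (k - a)) / 2)) by (apply cos_ge_0; lra).
  assert (Hle : cos ((b - k - (k - a)) / 2) <= cos ((b - a) / 2)).
  { destruct Hc as [Hc|Hc].
    - apply cos_decr_1; lra.
    - rewrite <- cos_neg. apply cos_decr_1; lra. }
  nra.
Qed.

Lemma sin_ge_half x : 0 <= x <= 1 -> x / 2 <= sin x.
Proof.
  intros Hx. assert (HPI := PI_gt_3).
  destruct (SIN x) as [H _]; try lra.
  eapply Rle_trans; [|exact H].
  (* This is the Taylor polynomial of degree 7: the cubic term costs at most [x / 6], and the last
     two terms together are nonnegative. *)
  unfold sin_lb, sin_approx, sin_term; simpl.
  assert (0 <= x * x <= 1) by nra.
  assert (x * (x * x) <= x) by nra.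
  assert (0 <= x * (x * x)) by nra.
  assert (0 <= x * (x * x) * (x * x)) by nra.
  assert (x * (x * x) * (x * x) * (x * x) <= x * (x * x) * (x * x)) by nra.
  lra.
Qed.

(** The long chord from [P_N] to [-P_0], with [t = 2^(-N)]; vertices at angles [k < t] lie beyond
    it. With [s] and [c] as in the proof, the sum is [2 c sin((1 + t) / 2 - k)], against [2 c s] on
    the chord. The sine exceeds [s] by at most [t], and [t <= 8 t s] because [s >= 1/8]. *)
Lemma last_chord_support t k :
  0 < t <= / 2 -> 0 <= k <= 1 ->
  Rabs (sin (t - k) + sin (1 - k)) <= (1 + 8 * t) * sin (1 - t).
Proof.
  intros Ht Hk. assert (HPI := PI_gt_3).
  rewrite form3.
  replace ((t - k - (1 - k)) / 2) with (- ((1 - t) / 2)) by field. rewrite cos_neg.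
  replace ((t - k + (1 - k)) / 2) with ((1 + t) / 2 - k) by field.
  replace (sin (1 - t)) with (2 * sin ((1 - t) / 2) * cos ((1 - t) / 2)).
  2:{ rewrite <- sin_2a. f_equal; field. }
  set (s := sin ((1 - t) / 2)). set (c := cos ((1 - t) / 2)).
  assert (Hc : 0 <= c) by (apply cos_ge_0; lra).
  assert (Hs : / 8 <= s).
  { assert ((1 - t) / 2 / 2 <= s) by (apply sin_ge_half; lra). lra. }
  assert (H1 : sin ((1 + t) / 2 - k) <= s + t).
  { apply Rle_trans with (sin ((1 + t) / 2)); [apply sin_incr_1; lra|].
    assert (H := form4 ((1 + t) / 2) ((1 - t) / 2)). fold s in H.
    replace (((1 + t) / 2 - (1 - t) / 2) / 2) with (t / 2) in H by field.
    replace (((1 + t) / 2 + (1 - t) / 2) / 2) with (/ 2) in H by field.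
    assert (Hst : sin (t / 2) <= t / 2) by (left; apply sin_lt_x; lra).
    assert (Hst0 : 0 <= sin (t / 2)) by (apply sin_ge_0; lra).
    assert (HC := COS_bound (/ 2)). nra. }
  assert (H2 : - s <= sin ((1 + t) / 2 - k)).
  { unfold s. rewrite <- sin_neg. apply sin_incr_1; lra. }
  assert (H3 : Rabs (sin ((1 + t) / 2 - k)) <= s * (1 + 8 * t)).
  { apply Rabs_le. nra. }
  rewrite !Rabs_mult, (Rabs_pos_eq 2), (Rabs_pos_eq c) by lra.
  nra.
Qed.

(* The edges of the polygon with vertices [P_0, ..., P_N, -P_0, ..., -P_N],
   up to central symmetry. *)
Definition edge (N n : nat) : pt * pt :=
  if Nat.ltb n N then (Pn (S n), Pn n) else (pscal (-1) (Pn 0), Pn N).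

Lemma edge_cases (N n : nat) (P : pt -> pt -> Prop) :
  (forall k, (k < N)%nat -> P (Pn (S k)) (Pn k)) -> P (pscal (-1) (Pn 0)) (Pn N) ->
  P (fst (edge N n)) (snd (edge N n)).
Proof.
  intros H1 H2. unfold edge. destruct (Nat.ltb_spec n N); simpl; auto.
Qed.

Lemma edge_Sgen N n : Sgen (fst (edge N n)) /\ Sgen (snd (edge N n)).
Proof.
  apply (edge_cases N n (fun A B => Sgen A /\ Sgen B)); intros;
    split; try apply Sgen_opp; apply Sgen_Pn.
Qed.

Lemma edge_det_pos N n : (1 <= N)%nat -> 0 < det (fst (edge N n)) (snd (edge N n)).
Proof.
  intros HN. assert (HPI := PI_gt_3).
  apply (edge_cases N n (fun A B => 0 < det A B)).
  - intros k _. rewrite det_Pn, inv_pow2_S.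
    assert (H := inv_pow2_pos k). assert (H' := inv_pow2_le_1 k).
    apply sin_gt_0; lra.
  - rewrite det_opp_l, det_Pn.
    assert (H := inv_pow2_pos N). assert (H' := inv_pow2_le 1 N HN).
    rewrite <- sin_neg. simpl in *. apply sin_gt_0; lra.
Qed.

(** Divided by [det A B], the left side is the absolute value of the first chart coordinate, which
    is 1 on the line through [A] and [B]. Short edges satisfy the bound without the term
    [8 * / 2 ^ N], which comes from the long edge. *)
Lemma edge_support_Pn N n k :
  (1 <= N)%nat -> let A := fst (edge N n) in let B := snd (edge N n) in
  Rabs (det (Pn k) B + det A (Pn k)) <= (1 + 8 * / 2 ^ N) * det A B.
Proof.
  intros HN. cbv zeta.
  assert (Hk := inv_pow2_pos k). assert (Hk' := inv_pow2_le_1 k).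
  assert (HN0 := inv_pow2_pos N). assert (HN' := inv_pow2_le 1 N HN).
  apply (edge_cases N n (fun A B =>
     Rabs (det (Pn k) B + det A (Pn k)) <= (1 + 8 * / 2 ^ N) * det A B)).
  - intros m _. rewrite !det_Pn.
    assert (Hm := inv_pow2_pos m). assert (Hm' := inv_pow2_le_1 m).
    assert (Hc : / 2 ^ k <= / 2 ^ S m \/ / 2 ^ m <= / 2 ^ k).
    { destruct (Nat.le_gt_cases k m); [right|left]; apply inv_pow2_le; lia. }
    destruct (chord_support (/ 2 ^ S m) (/ 2 ^ m) (/ 2 ^ k)) as [H1 H2]; auto;
      try (rewrite inv_pow2_S in *; lra).
    rewrite Rabs_pos_eq by exact H1. nra.
  - rewrite !det_opp_l, !det_Pn. simpl (/ 2 ^ 0). rewrite Rinv_1.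
    rewrite <- !sin_neg, !Ropp_minus_distr.
    apply last_chord_support; simpl in HN'; lra.
Qed.

Lemma edge_support N n x :
  (1 <= N)%nat -> closure Cex x -> let A := fst (edge N n) in let B := snd (edge N n) in
  Rabs (det x B + det A x) <= (1 + 8 * / 2 ^ N) * det A B.
Proof.
  intros HN Hx A B.
  assert (HS : forall y, Sgen y -> Rabs (det y B + det A y) <= (1 + 8 * / 2 ^ N) * det A B).
  { intros y [k [->| ->]]; [now apply edge_support_Pn|].
    rewrite det_opp_l, det_opp_r, <- Ropp_plus_distr, Rabs_Ropp.
    now apply edge_support_Pn. }
  assert (Hlin : forall y, det y B + det A y
    = (snd B - snd A) * fst y + (fst A - fst B) * snd y) by (intros; unfold det; ring).
  apply Rabs_le. split.
  - assert (H := closure_Cex_halfplane (- (snd B - snd A)) (- (fst A - fst B))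
      ((1 + 8 * / 2 ^ N) * det A B) x).
    rewrite Hlin. enough (- (snd B - snd A) * fst x + - (fst A - fst B) * snd x
      <= (1 + 8 * / 2 ^ N) * det A B) by lra.
    apply H; [|exact Hx]. intros y Hy. apply HS in Hy. rewrite Hlin in Hy.
    apply Rabs_le_inv in Hy. lra.
  - rewrite Hlin. apply closure_Cex_halfplane; [|exact Hx].
    intros y Hy. apply HS in Hy. rewrite Hlin in Hy. apply Rabs_le_inv in Hy. lra.
Qed.

Lemma sign_change (d : nat -> R) N :
  d O <= 0 -> 0 <= d (S N) -> exists k, (k < S N)%nat /\ d k <= 0 <= d (S k).
Proof.
  intros H0. induction N as [|N IH]; intros HN; [exists O; split; [lia|lra]|].
  destruct (Rle_dec 0 (d (S N))) as [H|H].
  - destruct (IH H) as [k [Hk Hk']]. exists k; split; [lia|exact Hk'].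
  - exists (S N); split; [lia|lra].
Qed.

(** The signs of [det (Pn k) x] decide. If they differ at the two ends, a discrete intermediate
    value argument finds a short edge; if they agree, the line through [x] meets the long edge. The
    two alternatives are the cone over the edge and its opposite. *)
Lemma edge_sector N x :
  (1 <= N)%nat -> exists n, (n < S N)%nat /\
    let A := fst (edge N n) in let B := snd (edge N n) in
    (0 <= det x B /\ 0 <= det A x) \/ (det x B <= 0 /\ det A x <= 0).
Proof.
  intros HN. set (d := fun k => det (Pn k) x).
  assert (Hd : forall k, det x (Pn k) = - d k) by (intros; unfold d, det; ring).
  assert (Hin : forall k, (k < N)%nat -> edge N k = (Pn (S k), Pn k)).
  { intros k Hk. unfold edge. destruct (Nat.ltb_spec k N); [reflexivity|lia]. }
  assert (Hlast : edge N N = (pscal (-1) (Pn 0), Pn N)).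
  { unfold edge. now rewrite Nat.ltb_irrefl. }
  destruct N as [|N]; [lia|].
  destruct (Rle_dec (d O) 0) as [H0|H0]; destruct (Rle_dec 0 (d (S N))) as [H1|H1].
  - destruct (sign_change d N H0 H1) as [k [Hk Hk']]. exists k. split; [lia|].
    rewrite (Hin k Hk). cbn [fst snd]. rewrite Hd. fold (d (S k)). left; lra.
  - exists (S N). split; [lia|]. rewrite Hlast. cbn [fst snd].
    rewrite Hd, det_opp_l. fold (d 0%nat). left; lra.
  - exists (S N). split; [lia|]. rewrite Hlast. cbn [fst snd].
    rewrite Hd, det_opp_l. fold (d 0%nat). right; lra.
  - destruct (sign_change (fun k => - d k) N) as [k [Hk Hk']]; try lra.
    exists k. split; [lia|].
    rewrite (Hin k Hk). cbn [fst snd]. rewrite Hd. fold (d (S k)). right; lra.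
Qed.

Lemma chart_opp A B a b :
  chart (pscal (-1) A) (pscal (-1) B) a b = chart A B (- a) (- b).
Proof. unfold chart, pscal; simpl; f_equal; field. Qed.

Lemma pscal_chart A B a b l : pscal l (chart A B a b) = chart A B (l * a) (l * b).
Proof. unfold chart, pscal; simpl; f_equal; ring. Qed.

Lemma Cex_0 : Cex (0, 0).
Proof.
  replace (0, 0) with (chart (fst (edge 1 0)) (snd (edge 1 0)) 0 0)
    by (unfold chart; f_equal; ring).
  assert (H := edge_det_pos 1 0 (Nat.le_refl 1)).
  apply Cex_chart; try apply edge_Sgen; lra.
Qed.

(* If the chord of the ray from [0] through [p] ends at [b], then [p = l b] where
   [(1 - s) / (1 - t) = 1 / (1 - l)], and the other factor [t / s] of the cross ratio
   is at least [1]. *)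
Lemma hilbert_ball_scaled R0 p :
  0 <= R0 -> hilbert_ball Cex R0 p ->
  exists l b, closure Cex b /\ 0 <= l <= 1 - exp (- (2 * R0)) /\ p = pscal l b.
Proof.
  intros HR [Hp [r [Hd Hr]]].
  destruct Hd as [[E _]|[Hne (a & b & s & t & _ & [Hb _] & Hs & Hst & Ht & E0 & Ep & Er)]].
  - exists 0, (0, 0). split; [apply subset_closure, Cex_0|]. split.
    + assert (exp (- (2 * R0)) <= exp 0); [|rewrite exp_0 in *; lra].
      destruct (Req_dec R0 0) as [->|HR']; [right; f_equal; ring|].
      left; apply exp_increasing; lra.
    + rewrite <- E. unfold pscal; simpl; f_equal; ring.
  - exists ((t - s) / (1 - s)), b. split; [exact Hb|].
    assert (Hl : 0 < (1 - t) / (1 - s)) by (apply Rdiv_lt_0_compat; lra).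
    replace ((t - s) / (1 - s)) with (1 - (1 - t) / (1 - s)) by (field; lra).
    split; [split|].
    + assert ((1 - t) / (1 - s) <= 1); [|lra].
      apply Rmult_le_reg_r with (1 - s); [lra|].
      replace ((1 - t) / (1 - s) * (1 - s)) with (1 - t) by (field; lra). lra.
    + assert (exp (- (2 * R0)) <= (1 - t) / (1 - s)); [|lra].
      set (q := (1 - s) / s * (t / (1 - t))) in *.
      assert (Hq : (1 - s) / (1 - t) <= q).
      { unfold q. replace ((1 - s) / s * (t / (1 - t))) with ((1 - s) / (1 - t) * (t / s))
          by (field; lra).
        assert (0 < (1 - s) / (1 - t)) by (apply Rdiv_lt_0_compat; lra).
        assert (1 <= t / s).
        { apply Rmult_le_reg_r with s; [lra|].
          replace (t / s * s) with t by (field; lra). lra. }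
        nra. }
      assert (Hq0 : 0 < (1 - s) / (1 - t)) by (apply Rdiv_lt_0_compat; lra).
      replace ((1 - t) / (1 - s)) with (/ ((1 - s) / (1 - t))) by (field; lra).
      rewrite exp_Ropp. apply Rinv_le_contravar; [exact Hq0|].
      apply Rle_trans with (1 := Hq).
      rewrite <- (exp_ln q) by lra.
      left. apply exp_increasing. lra.
    + destruct a as [a1 a2], b as [b1 b2], p as [p1 p2].
      unfold padd, pscal in *; simpl in *.
      injection E0; injection Ep; intros -> -> E2 E1.
      (* The origin lies on the chord, so [a] is a negative multiple of [b] and can be eliminated
         from the formula for [p]. *)
      assert (Ea1 : a1 = - (s / (1 - s)) * b1).
      { apply Rmult_eq_reg_l with (1 - s); [|lra].
        replace ((1 - s) * (- (s / (1 - s)) * b1)) with (- (s * b1)) by (field; lra). lra. }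
      assert (Ea2 : a2 = - (s / (1 - s)) * b2).
      { apply Rmult_eq_reg_l with (1 - s); [|lra].
        replace ((1 - s) * (- (s / (1 - s)) * b2)) with (- (s * b2)) by (field; lra). lra. }
      rewrite Ea1, Ea2. f_equal; field; lra.
Qed.

Lemma hilbert_ball_cover N R0 p :
  (1 <= N)%nat -> 0 <= R0 -> 16 * / 2 ^ N <= exp (- (2 * R0)) -> hilbert_ball Cex R0 p ->
  exists n, (n < S N)%nat /\
    exists a b, 0 <= a <= 1 - / 2 ^ N /\ Rabs b <= 1 - / 2 ^ N /\
    (p = chart (fst (edge N n)) (snd (edge N n)) a b \/
     p = chart (pscal (-1) (fst (edge N n))) (pscal (-1) (snd (edge N n))) a b).
Proof.
  intros HN HR He Hp.
  destruct (hilbert_ball_scaled R0 p HR Hp) as (l & x & Hx & Hl & ->).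
  destruct (edge_sector N x HN) as [n [Hn Hsec]]. exists n. split; [exact Hn|].
  assert (HD := edge_det_pos N n HN). assert (HS := edge_support N n x HN Hx).
  cbv zeta in *. set (A := fst (edge N n)) in *. set (B := snd (edge N n)) in *.
  set (D := det A B) in *. set (th := / 2 ^ N) in *. set (e := exp (- (2 * R0))) in *.
  assert (Hth : 0 < th) by apply inv_pow2_pos.
  set (u := det x B / D). set (v := det A x / D).
  assert (Eu : det x B = u * D) by (unfold u; field; lra).
  assert (Ev : det A x = v * D) by (unfold v; field; lra).
  assert (Ex : x = chart A B (u + v) (u - v)).
  { rewrite (chart_surj A B x) at 1 by (fold D; lra). fold D. f_equal; unfold u, v; field; lra. }
  rewrite Eu, Ev, <- Rmult_plus_distr_r, Rabs_mult, (Rabs_pos_eq D) in HS by lra.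
  apply Rmult_le_reg_r in HS; [|exact HD].
  (* The scaling absorbs the part outside the polygon: this needs [9 th <= e (1 + 8 th)], which
     [16 th <= e] provides. *)
  assert (Hlam : l * (1 + 8 * th) <= 1 - th).
  { apply Rle_trans with ((1 - e) * (1 + 8 * th)); [apply Rmult_le_compat_r; lra|]. nra. }
  assert (Habs : forall t, Rabs t <= 1 + 8 * th -> Rabs (l * t) <= 1 - th).
  { intros t Ht. rewrite Rabs_mult, (Rabs_pos_eq l) by lra.
    apply Rle_trans with (2 := Hlam). apply Rmult_le_compat_l; lra. }
  assert (Hsgn : (0 <= u /\ 0 <= v) \/ (u <= 0 /\ v <= 0)).
  { rewrite Eu, Ev in Hsec. destruct Hsec as [[H1 H2]|[H1 H2]]; [left|right]; split;
      apply Rmult_le_reg_r with D; lra. }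
  (* In the cone [u] and [v] have equal sign, so the support bound on the first coordinate also
     controls the second. *)
  assert (Hdiff : Rabs (u - v) <= Rabs (u + v)).
  { unfold Rabs; repeat destruct Rcase_abs; lra. }
  assert (G1 := Habs (u + v) HS). assert (G2 := Habs (u - v) (Rle_trans _ _ _ Hdiff HS)).
  rewrite Ex, pscal_chart.
  apply Rabs_le_inv in G1.
  destruct Hsgn as [[H1 H2]|[H1 H2]].
  - exists (l * (u + v)), (l * (u - v)). repeat split; try lra; [|now left].
    apply Rmult_le_pos; lra.
  - exists (- (l * (u + v))), (- (l * (u - v))). rewrite Rabs_Ropp. repeat split; try lra.
    + assert (0 <= l * - (u + v)) by (apply Rmult_le_pos; lra). lra.
    + right. rewrite chart_opp, !Ropp_involutive. reflexivity.
Qed.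

(** Convertible with the set that [hilbert_measure] measures for the ball, so content bounds apply
    to the measure directly. *)
Definition ball_subgraph (R0 : R) (x : pt3) : Prop :=
  hilbert_ball Cex R0 (fst x) /\ subgraph x.

Lemma content_le_ball N R0 :
  (1 <= N)%nat -> 0 <= R0 -> 16 * / 2 ^ N <= exp (- (2 * R0)) ->
  content_le (ball_subgraph R0)
    (INR (S N) * (2 * PI * INR N ^ 2 + 2 * PI * INR N ^ 2)).
Proof.
  intros HN HR He.
  set (cone := fun A B x => (exists a b, 0 <= a <= 1 - / 2 ^ N /\ Rabs b <= 1 - / 2 ^ N /\
     fst x = chart A B a b) /\ subgraph x).
  apply (content_le_mono (fun x => exists n, (n < S N)%nat /\
    (cone (fst (edge N n)) (snd (edge N n)) x \/
     cone (pscal (-1) (fst (edge N n))) (pscal (-1) (snd (edge N n))) x)) _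
    (INR (S N) * (2 * PI * INR N ^ 2 + 2 * PI * INR N ^ 2)) _); [|lra|].
  - intros x [Hb Hs].
    destruct (hilbert_ball_cover N R0 (fst x) HN HR He Hb)
      as (n & Hn & a & b & Ha & Hb' & [E|E]); exists n; (split; [exact Hn|]);
      [left|right]; (split; [exists a, b; auto|exact Hs]).
  - apply content_le_bigunion. intros n _. assert (HD := edge_det_pos N n HN).
    destruct (edge_Sgen N n) as [HA HB].
    apply content_le_union; apply content_le_cone; auto using Sgen_opp; try lra.
    rewrite det_opp_l, det_opp_r. lra.
Qed.

(** * Two-sided bounds for the measure of the balls *)

Lemma pow2_ge_exp k : exp (INR k / 2) <= 2 ^ k.
Proof.
  induction k as [|k IH]; [simpl; unfold Rdiv; rewrite Rmult_0_l, exp_0; lra|].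
  rewrite S_INR. replace ((INR k + 1) / 2) with (/ 2 + INR k / 2) by field.
  rewrite exp_plus. simpl. apply Rmult_le_compat; try (left; apply exp_pos); [|exact IH].
  assert (H := exp_le_3). assert (H' := exp_pos (/ 2)).
  replace 1 with (/ 2 + / 2) in H by field. rewrite exp_plus in H. nra.
Qed.

(** [N = 4 + k]: the 4 cancels the factor 16, and [k > 4 R0] gives
    [2^k >= exp (k / 2) > exp (2 R0)]. *)
Lemma radius_scale R0 :
  0 <= R0 -> exists N, (1 <= N)%nat /\ 16 * / 2 ^ N <= exp (- (2 * R0)) /\ INR N <= 4 * R0 + 5.
Proof.
  intros HR. destruct (archimed (4 * R0)) as [H1 H2].
  set (k := Z.to_nat (up (4 * R0))).
  assert (Hk : INR k = IZR (up (4 * R0))).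
  { unfold k. rewrite INR_IZR_INZ, Z2Nat.id; [reflexivity|]. apply le_IZR; lra. }
  exists (4 + k)%nat. repeat split; [lia| |].
  - rewrite pow_add, Rinv_mult, exp_Ropp.
    replace (16 * (/ 2 ^ 4 * / 2 ^ k)) with (/ 2 ^ k) by (simpl; field; apply pow_nonzero; lra).
    apply Rinv_le_contravar; [apply exp_pos|].
    apply Rle_trans with (2 := pow2_ge_exp k).
    left; apply exp_increasing; lra.
  - rewrite plus_INR. simpl INR. lra.
Qed.

Lemma ball_measure_exists R0 :
  exists m, hilbert_measure Cex (hilbert_ball Cex R0) m.
Proof.
  apply lebesgue3_exists.
  (* A negative radius is handled through radius 0, by monotonicity. *)
  destruct (radius_scale (Rmax R0 0) (Rmax_r _ _)) as (N & HN & He & _).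
  destruct (content_le_cover _ _ 1 (content_le_ball N _ HN (Rmax_r _ _) He) Rlt_0_1)
    as [c [Hc _]].
  exists c. revert Hc. apply cover_sum3_mono.
  intros x [[Hx [r [Hd Hr]]] Hs]. split; [|exact Hs].
  split; [exact Hx|]. exists r. split; [exact Hd|].
  apply Rlt_le_trans with (1 := Hr). apply Rmax_l.
Qed.

Lemma ball_measure_upper R0 m :
  0 <= R0 -> hilbert_measure Cex (hilbert_ball Cex R0) m -> m <= 16 * (4 * R0 + 6) ^ 3.
Proof.
  intros HR Hm. destruct (radius_scale R0 HR) as (N & HN & He & Hle).
  assert (H := content_le_lebesgue3 _ _ _ (content_le_ball N R0 HN HR He) Hm).
  apply Rle_trans with (1 := H).
  assert (HN0 := pos_INR N). assert (HPI := PI_4). assert (HPI' := PI_RGT_0).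
  rewrite S_INR.
  replace ((INR N + 1) * (2 * PI * INR N ^ 2 + 2 * PI * INR N ^ 2)) with
    (4 * PI * ((INR N + 1) * INR N ^ 2)) by ring.
  assert (INR N ^ 2 <= (4 * R0 + 6) ^ 2) by (apply pow_incr; lra).
  assert (0 <= INR N ^ 2) by apply pow2_ge_0.
  apply Rmult_le_compat; try lra; [apply Rmult_le_pos; lra|].
  replace ((4 * R0 + 6) ^ 3) with ((4 * R0 + 6) * (4 * R0 + 6) ^ 2) by ring.
  apply Rmult_le_compat; lra.
Qed.

(** On the chord from [- tm p] to [tp p], of parameter length [tm + tp], the origin sits at [tm] and
    [p] at [tm + 1]. The cross ratio is a product of two factors at most 3/2, and
    [9/4 < 3 < exp 2]. *)
Lemma hilbert_dist_of_exit p tm tp :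
  p <> (0, 0) -> 3 <= tm -> 3 <= tp -> boundary Cex (pscal (- tm) p) ->
  boundary Cex (pscal tp p) -> exists r, hilbert_dist Cex (0, 0) p r /\ r < 1.
Proof.
  intros Hp Hm Ht Bm Bp.
  set (s := tm / (tm + tp)). set (t := (1 + tm) / (tm + tp)).
  exists (/ 2 * ln ((1 - s) / s * (t / (1 - t)))). split.
  - right. split; [now intros E; apply Hp|].
    exists (pscal (- tm) p), (pscal tp p), s, t.
    assert (Es : s * (tm + tp) = tm) by (unfold s; field; lra).
    assert (Et : t * (tm + tp) = 1 + tm) by (unfold t; field; lra).
    repeat split; try apply Bm; try apply Bp; try nra;
      destruct p as [p1 p2]; unfold padd, pscal, s, t; simpl; f_equal; field; lra.
  - replace ((1 - s) / s * (t / (1 - t))) with (tp / (tp - 1) * ((1 + tm) / tm))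
      by (unfold s, t; field; lra).
    assert (H1 : tp / (tp - 1) <= 3 / 2).
    { apply Rmult_le_reg_r with (tp - 1); [lra|].
      replace (tp / (tp - 1) * (tp - 1)) with tp by (field; lra). lra. }
    assert (H2 : (1 + tm) / tm <= 3 / 2).
    { apply Rmult_le_reg_r with tm; [lra|].
      replace ((1 + tm) / tm * tm) with (1 + tm) by (field; lra). lra. }
    assert (H3 : 0 < tp / (tp - 1)) by (apply Rdiv_lt_0_compat; lra).
    assert (H4 : 0 < (1 + tm) / tm) by (apply Rdiv_lt_0_compat; lra).
    assert (H5 : tp / (tp - 1) * ((1 + tm) / tm) < exp 2).
    { apply Rle_lt_trans with (3 / 2 * (3 / 2)).
      - apply Rmult_le_compat; lra.
      - assert (H := exp_ineq1 2 ltac:(lra)). lra. }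
    apply ln_increasing in H5; [|nra]. rewrite ln_exp in H5. lra.
Qed.

(** The box with base [[-rho, rho]^2] and height 1/2 lies in the subgraph over the ball, and its
    volume is [2 rho^2]. *)
Lemma ball_measure_lower :
  exists c0, 0 < c0 /\ forall R0 m, 1 <= R0 ->
    hilbert_measure Cex (hilbert_ball Cex R0) m -> c0 <= m.
Proof.
  destruct (edge_Sgen 1 0) as [HA HB].
  assert (HD := edge_det_pos 1 0 (Nat.le_refl 1)).
  set (A := fst (edge 1 0)) in *. set (B := snd (edge 1 0)) in *. set (D := det A B) in *.
  (* Chart coordinates over the base are then at most [4 rho / D = 1/4] in absolute value, so [t p]
     stays in the set for [|t| <= 3], as [hilbert_dist_of_exit] requires. *)
  set (rho := D / 16).
  assert (Hrho : 0 < rho) by (unfold rho; lra).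
  exists (2 * rho ^ 2). split; [assert (0 < rho ^ 2) by (apply pow_lt; lra); lra|].
  intros R0 m HR [_ Hm]. apply Rle_plus_eps. intros eps.
  destruct (Hm eps (cond_pos eps)) as [c [Hc Hlt]].
  enough (H : 2 * rho ^ 2 <= c) by lra.
  assert (H := cover_sum3_ge _ c 1 0 0 1 ((- rho, - rho, 0), (rho, rho, / 2)) ltac:(lra)
    ltac:(unfold valid; simpl; lra) Hc).
  replace (2 * rho ^ 2) with
    (Rabs (1 * 1 - 0 * 0) * vol (- rho, - rho, 0, (rho, rho, / 2))).
  2:{ replace (1 * 1 - 0 * 0) with 1 by ring. rewrite Rabs_R1. unfold vol; simpl; field. }
  apply H. clear H. intros [[x y] z] (Hx & Hy & Hz). simpl in Hx, Hy, Hz.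
  unfold lin. cbn [fst snd].
  replace (1 * x + 0 * y) with x by ring. replace (0 * x + 1 * y) with y by ring.
  set (p := (x, y)).
  destruct (chart_coord_bound A B p rho HA HB) as [G1 G2]; try (apply Rabs_le; simpl; lra).
  { fold D; lra. }
  fold D in G1, G2. rewrite (Rabs_pos_eq D) in G1, G2 by lra.
  set (a := (det p B + det A p) / D) in *. set (b := (det p B - det A p) / D) in *.
  replace (4 * rho / D) with (/ 4) in G1, G2 by (unfold rho; field; lra).
  assert (Ep : p = chart A B a b) by (apply chart_surj; fold D; lra).
  assert (Hab : forall t, -3 <= t <= 3 -> Cex (pscal t p)).
  { intros t Ht. rewrite Ep, pscal_chart.
    assert (G : forall q, Rabs q <= / 4 -> -1 < t * q < 1).
    { intros q Hq. apply Rabs_lt_1. rewrite Rabs_mult.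
      assert (Rabs t <= 3) by (apply Rabs_le; lra).
      assert (Rabs t * Rabs q <= 3 * / 4)
        by (apply Rmult_le_compat; auto; apply Rabs_pos). lra. }
    apply Cex_chart; auto. fold D; lra. }
  split; [split|].
  - replace p with (pscal 1 p) by (unfold pscal, p; simpl; f_equal; ring). apply Hab; lra.
  - destruct (classic (p = (0, 0))) as [E|E].
    + exists 0. split; [left; auto|lra].
    + assert (E0 : forall q, padd (0, 0) q = q)
        by (intros [q1 q2]; unfold padd; simpl; f_equal; ring).
      assert (Es : forall t, pscal t (pscal (-1) p) = pscal (- t) p)
        by (intros t; unfold pscal; simpl; f_equal; ring).
      destruct (exit_point (0, 0) p 3 E) as [tp [Hp Bp]]; [lra| |].
      { intros t Ht. rewrite E0. apply Hab; lra. }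
      destruct (exit_point (0, 0) (pscal (-1) p) 3) as [tm [Htm Bm]]; [|lra| |].
      { intros En. apply E. injection En. unfold p; simpl. intros E2 E1. f_equal; lra. }
      { intros t Ht. rewrite E0, Es. apply Hab; lra. }
      rewrite E0 in Bp, Bm. rewrite Es in Bm.
      destruct (hilbert_dist_of_exit p tm tp E Htm Hp Bm Bp) as [r [Hd Hr]].
      exists r. split; [exact Hd|lra].
  - destruct (finsler_ball_area_exists p) as [w [Hw Hw4]].
    exists w. split; [exact Hw|].
    rewrite Ep in Hw. apply Rabs_le_inv in G1 as G1'. apply Rabs_le_inv in G2 as G2'.
    assert (Hpos := finsler_ball_area_ge A B a b w HA HB ltac:(fold D; lra) ltac:(lra)
      ltac:(lra) Hw).
    fold D in Hpos. rewrite (Rabs_pos_eq D) in Hpos by lra.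
    assert (Hw0 : 0 < w).
    { eapply Rlt_le_trans; [|exact Hpos].
      apply Rmult_lt_0_compat; [lra|apply Rmult_lt_0_compat; lra]. }
    (* The density is at least [PI / 4 > 3 / 4], since the Finsler ball has area at most 4. *)
    split; [lra|]. apply Rlt_le_trans with (3 / 4); [lra|].
    assert (HPI := PI_gt_3). unfold Rdiv. apply Rmult_le_compat; try lra.
    apply Rinv_le_contravar; lra.
Qed.

(** * Passage to the limit *)

Lemma ln_le x y : 0 < x -> x <= y -> ln x <= ln y.
Proof. intros Hx [H| ->]; [left; now apply ln_increasing|lra]. Qed.

Lemma ln_le_sqrt x : 0 < x -> ln x <= 2 * sqrt x.
Proof.
  intros Hx. assert (Hs := sqrt_lt_R0 x Hx).
  replace (ln x) with (2 * ln (sqrt x)).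
  - assert (ln (sqrt x) < sqrt x); [|lra].
    apply exp_lt_inv. rewrite exp_ln by exact Hs.
    assert (H := exp_ineq1 (sqrt x) ltac:(lra)). lra.
  - rewrite <- (sqrt_sqrt x) at 2 by lra. rewrite ln_mult; lra.
Qed.

Theorem theorem4p2 :
  exists f : R -> R,
    (forall R0 : R, hilbert_measure Cex (hilbert_ball Cex R0) (f R0)) /\
    (forall eps : R, 0 < eps ->
       exists M : R, forall R0 : R, M < R0 -> Rabs (ln (f R0) / R0) < eps).
Proof.
  destruct (choice _ ball_measure_exists) as [f Hf].
  exists f. split; [exact Hf|]. intros eps He.
  destruct ball_measure_lower as [c0 [Hc0 Hlow]].
  set (K := Rabs (ln c0) + ln 16).
  assert (HK : 0 <= ln 16) by (rewrite <- ln_1; left; apply ln_increasing; lra).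
  assert (HK0 := Rabs_pos (ln c0)).
  (* The second threshold puts the constants below [eps * R0 / 2]. The third does the same for
     [6 * sqrt (4 * R0 + 6)]: as [4 R0 + 6 < 10 R0], squaring leaves
     [4 * 36 * 10 = 1440 < eps^2 R0]. *)
  exists (Rmax 1 (Rmax (2 * K / eps) (1440 / (eps * eps)))). intros R0 HR0.
  assert (HR1 : 1 < R0) by (eapply Rle_lt_trans; [apply Rmax_l|exact HR0]).
  assert (HR2 : 2 * K / eps < R0).
  { eapply Rle_lt_trans; [|exact HR0].
    eapply Rle_trans; [apply Rmax_l|apply Rmax_r]. }
  assert (HR3 : 1440 / (eps * eps) < R0).
  { eapply Rle_lt_trans; [|exact HR0].
    eapply Rle_trans; [apply Rmax_r|apply Rmax_r]. }
  assert (HR2' : 2 * K < eps * R0).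
  { apply Rmult_lt_reg_l with (/ eps); [now apply Rinv_0_lt_compat|].
    replace (/ eps * (eps * R0)) with R0 by (field; lra). unfold Rdiv in HR2. lra. }
  assert (HR3' : 1440 < eps * eps * R0).
  { apply Rmult_lt_reg_l with (/ (eps * eps)); [apply Rinv_0_lt_compat; nra|].
    replace (/ (eps * eps) * (eps * eps * R0)) with R0 by (field; lra).
    unfold Rdiv in HR3. lra. }
  assert (Hl := Hlow R0 (f R0) ltac:(lra) (Hf R0)).
  assert (Hu := ball_measure_upper R0 (f R0) ltac:(lra) (Hf R0)).
  assert (Hln1 : ln c0 <= ln (f R0)) by (apply ln_le; lra).
  assert (Hln2 : ln (f R0) <= ln 16 + 6 * sqrt (4 * R0 + 6)).
  { apply Rle_trans with (ln (16 * (4 * R0 + 6) ^ 3)); [apply ln_le; lra|].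
    rewrite ln_mult by (try apply pow_lt; lra). rewrite ln_pow by lra.
    assert (H := ln_le_sqrt (4 * R0 + 6) ltac:(lra)). simpl INR. lra. }
  assert (Hsq : 6 * sqrt (4 * R0 + 6) < eps * R0 / 2).
  { assert (Hs0 := sqrt_pos (4 * R0 + 6)).
    assert (Hs := sqrt_sqrt (4 * R0 + 6) ltac:(lra)).
    apply Rsqr_incrst_0; [unfold Rsqr; nra|lra|nra]. }
  assert (Hc := Rabs_le_inv (ln c0) _ (Rle_refl _)).
  unfold Rdiv. rewrite Rabs_mult, Rabs_inv, (Rabs_pos_eq R0) by lra.
  apply Rmult_lt_reg_r with R0; [lra|]. rewrite Rmult_assoc, Rinv_l, Rmult_1_r by lra.
  unfold K in *. apply Rabs_def1; lra.
Qed.
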